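(* Let $M$ be a connected finite-dimensional Riemannian manifold of positive dimension with Riemannian distance $d$, and let $f\colon M\to M$ be a $C^1$ diffeomorphism that is Anosov with respect to the Riemannian metric of $M$, with Anosov splitting $TM=E^s\oplus E^u$. Suppose that $f$ has the Lipschitz shadowing property (with respect to $d$) with constant $L\geq 1$. For $x\in M$ let $\pi_x^s\colon T_xM\to E_x^s$ and $\pi_x^u\colon T_xM\to E_x^u$ be the complementary projections associated with the splitting $T_xM=E_x^s\oplus E_x^u$. Then for every $x\in M$ $$\|\pi_x^s\|\leq L,\qquad \|\pi_x^u\|\leq L,$$ and consequently $$\sin\angle(E_x^s,E_x^u)\geq\frac1L .$$ In particular, the stable and unstable bundles $E^s$ and $E^u$ are uniformly transverse.
   Context: No compactness or completeness of $M$ is assumed. **Anosov.** A $C^1$ diffeomorphism $f\colon M\to M$ is Anosov with respect to a Riemannian metric (with induced norm $\|\cdot\|$) if there exist a continuous $Df$-invariant splitting $TM=E^s\oplus E^u$ and constants $C>0$, $\lambda\in(0,1)$ such that $$\|Df_x^n|_{E_x^s}\|\leq C\lambda^n,\qquad \|Df_x^{-n}|_{E_x^u}\|\leq C\lambda^n$$ for every $x\in M$ and every integer $n\geq 0$. The bundles $E^s$, $E^u$ are called the stable and unstable bundles; one of them may be zero. **Lipschitz shadowing.** A sequence $(x_n)_{n\in\mathbb Z}$ in $M$ is a $\delta$-pseudo-orbit of $f$ if $d(f(x_n),x_{n+1})\leq\delta$ for every $n\in\mathbb Z$. The map $f$ has the Lipschitz shadowing property with constant $L$ if there is $\delta_0>0$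 such that for every $0<\delta<\delta_0$ and every $\delta$-pseudo-orbit $(x_n)_{n\in\mathbb Z}$ there is $z\in M$ with $d(f^n(z),x_n)\leq L\delta$ for every $n\in\mathbb Z$. **Angle.** For complementary subspaces $E,F$ of a finite-dimensional inner product space, $$\sin\angle(E,F)=\inf_{v\in F,\ \|v\|=1}\operatorname{dist}(v,E),$$ and if either subspace is zero, the angle is set equal to $\pi/2$ (so $\sin\angle(E,F)=1$). Uniformly transverse means that the angle $\angle(E^s_x,E^u_x)$ is bounded away from zero uniformly in $x\in M$. Norms of projections are operator norms for the Riemannian norm on $T_xM$. *)

(* Defs.v *)
From HB Require Import structures.
From mathcomp Require Import all_boot all_order all_algebra.
From mathcomp Require Import all_classical all_reals all_analysis.

Set Implicit Arguments.
Unset Strict Implicit.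
Unset Printing Implicit Defensive.
Import Order.TTheory GRing.Theory Num.Theory.
Import numFieldNormedType.Exports.
Local Open Scope classical_set_scope.
Local Open Scope ring_scope.

(* For open U and finite-dimensional V, f is C^k on U. *)
Fixpoint Ck (R : realType) (V W : normedModType R) (k : nat) (U : set V)
    (f : V -> W) : Prop :=
  match k with
  | 0 => {in U, continuous f}
  | k'.+1 => (forall x, U x -> differentiable f x) /\
             forall v : V, Ck k' U (fun x => 'd f x v)
  end.

Definition Cinfty (R : realType) (V W : normedModType R) (U : set V)
  (f : V -> W) : Prop := forall k, Ck k U f.

(* The two maps of a chart are total functions; only their values on the open
   sets chart_dom and chart_cod matter. *)
Record chart (R : realType) (n : nat) (M : topologicalType) := Chart {
  chart_dom : set M;
  chart_cod : set 'rV[R]_n.+1;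
  fwd : M -> 'rV[R]_n.+1;
  bwd : 'rV[R]_n.+1 -> M;
  chart_dom_open : open chart_dom;
  chart_cod_open : open chart_cod;
  fwd_cod : forall x, chart_dom x -> chart_cod (fwd x);
  bwd_dom : forall p, chart_cod p -> chart_dom (bwd p);
  fwdK : forall x, chart_dom x -> bwd (fwd x) = x;
  bwdK : forall p, chart_cod p -> fwd (bwd p) = p;
  fwd_continuous : {in chart_dom, continuous fwd};
  bwd_continuous : {in chart_cod, continuous bwd}
}.

(* C^oo structure of dimension n.+1.  The structure includes the choice, at each
   x, of a preferred chart around x: the tangent space T_x M is the coordinate
   space 'rV[R]_n.+1 of that chart, and all tangent vectors below are written in
   these coordinates. *)
Record manifold (R : realType) (n : nat) (M : topologicalType) := Manifold {
  atlas : set (chart R n M);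
  chart_at : M -> chart R n M;
  chart_at_atlas : forall x, atlas (chart_at x);
  chart_at_dom : forall x, chart_dom (chart_at x) x;
  transition_smooth : forall c1 c2, atlas c1 -> atlas c2 ->
    Cinfty (chart_cod c1 `&` bwd c1 @^-1` chart_dom c2) (fwd c2 \o bwd c1);
  manifold_hausdorff : hausdorff_space M;
  manifold_second_countable : @second_countable M
}.

Section Manifold.
Variables (R : realType) (n : nat) (M : topologicalType) (X : manifold R n M).
Local Notation E := 'rV[R]_n.+1.
Implicit Types (h : M -> M) (x y : M) (c : chart R n M) (gamma : R -> M).

Definition C1_map h : Prop :=
  continuous h /\
  forall c1 c2, atlas X c1 -> atlas X c2 ->
    Ck 1 (chart_cod c1 `&` (h \o bwd c1) @^-1` chart_dom c2)
         (fwd c2 \o h \o bwd c1).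

Definition C1_diffeo (f finv : M -> M) : Prop :=
  [/\ cancel f finv, cancel finv f, C1_map f & C1_map finv].

(* f^k for k in Z, where finv is the inverse of f. *)
Definition iterz (f finv : M -> M) (k : int) : M -> M :=
  match k with
  | Posz m => iter m f
  | Negz m => iter m.+1 finv
  end.

Definition tangent_map h x : {linear E -> E} :=
  'd (fwd (chart_at X (h x)) \o h \o bwd (chart_at X x))
     (fwd (chart_at X x) x).

(* Change of coordinates from T_y M to the chart c around y, and back. *)
Definition to_chart c y : {linear E -> E} :=
  'd (fwd c \o bwd (chart_at X y)) (fwd (chart_at X y) y).

Definition of_chart c y : {linear E -> E} :=
  'd (fwd (chart_at X y) \o bwd c) (fwd c y).

Record riemannian_metric := RiemannianMetric {
  inner : M -> E -> E -> R;
  inner_linear : forall x a u v w,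
    inner x (a *: u + v) w = a * inner x u w + inner x v w;
  inner_sym : forall x u v, inner x u v = inner x v u;
  inner_posdef : forall x v, v != 0 -> 0 < inner x v v;
  inner_smooth : forall c, atlas X c -> forall v w : E,
    Cinfty (W := R^o) (chart_cod c) (fun p =>
      inner (bwd c p) (of_chart c (bwd c p) v) (of_chart c (bwd c p) w))
}.

Definition C1_curve gamma : Prop :=
  continuous gamma /\
  forall c, atlas X c ->
    Ck (V := R^o) 1 (gamma @^-1` chart_dom c) (fwd c \o gamma).

(* 0 = s_0 < s_1 < ... < s_k = 1, and on each closed [s_i, s_(i+1)] gamma is the
   restriction of a C^1 curve; continuity on [0, 1] follows. *)
Definition piecewise_C1 gamma : Prop :=
  exists s : seq R, [/\ path <%R 0 s, last 0 s = 1 &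
    forall i, (i < size s)%N -> exists2 sigma, C1_curve sigma &
      forall t : R, nth 0 (0 :: s) i <= t <= nth 0 s i -> gamma t = sigma t].

Definition velocity gamma (t : R) : E :=
  derive1 (fwd (chart_at X (gamma t)) \o gamma) t.

Variable g : riemannian_metric.

Definition tnorm x (v : E) : R := Num.sqrt (inner g x v v).

Definition curve_length gamma : \bar R :=
  (\int[lebesgue_measure]_(t in `[0%R, 1%R])
     (tnorm (gamma t) (velocity gamma t))%:E)%E.

Definition rdist x y : \bar R :=
  ereal_inf [set curve_length gamma | gamma in
    [set gamma | [/\ piecewise_C1 gamma, gamma 0 = x & gamma 1 = y]]].

(* Operator norm of the restriction to U of a linear map A : T_x M -> T_y M. *)
Definition op_norm x y (U : {vspace E}) (A : E -> E) : \bar R :=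
  ereal_sup [set (tnorm y (A v))%:E | v in
    [set v | v \in U /\ tnorm x v <= 1]].

(* F is locally spanned by a continuous frame. *)
Definition continuous_subbundle (F : M -> {vspace E}) : Prop :=
  forall x, exists k, exists s : 'I_k -> M -> E,
    \forall y \near x,
      basis_of (F y) [seq s i y | i <- enum 'I_k] /\
      forall i c, atlas X c -> chart_dom c y ->
        {for y, continuous (fun z => to_chart c z (s i z) : E)}.

Definition anosov_splitting (f finv : M -> M) (Es Eu : M -> {vspace E}) : Prop :=
  [/\ forall x, (Es x + Eu x)%VS = fullv /\ (Es x :&: Eu x)%VS = 0%VS,
      continuous_subbundle Es /\ continuous_subbundle Eu,
      forall x, (linfun (tangent_map f x) @: Es x)%VS = Es (f x) /\
                (linfun (tangent_map f x) @: Eu x)%VS = Eu (f x) &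
      exists C lambda : R, [/\ 0 < C, 0 < lambda < 1 &
        forall x k,
          (op_norm x (iter k f x) (Es x) (tangent_map (iter k f) x)
             <= (C * lambda ^+ k)%:E)%E /\
          (op_norm x (iter k finv x) (Eu x) (tangent_map (iter k finv) x)
             <= (C * lambda ^+ k)%:E)%E]].

Definition pseudo_orbit (f : M -> M) (delta : R) (xs : int -> M) : Prop :=
  forall k : int, (rdist (f (xs k)) (xs (k + 1)%R) <= delta%:E)%E.

Definition lipschitz_shadowing (f finv : M -> M) (L : R) : Prop :=
  exists2 delta0 : R, 0 < delta0 &
    forall delta : R, 0 < delta < delta0 ->
    forall xs, pseudo_orbit f delta xs ->
    exists z, forall k, (rdist (iterz f finv k z) (xs k) <= (L * delta)%:E)%E.

Definition dist_to x (v : E) (U : {vspace E}) : R :=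
  inf [set tnorm x (v - w) | w in [set w | w \in U]].

Definition angle x (U W : {vspace E}) : R :=
  if (U == 0%VS) || (W == 0%VS) then pi / 2
  else asin (inf [set dist_to x v U | v in
                   [set v | v \in W /\ tnorm x v = 1]]).

Definition uniformly_transverse (U W : M -> {vspace E}) : Prop :=
  exists2 a : R, 0 < a & forall x, a <= angle x (U x) (W x).

End Manifold.

(* Main.v *)
Require Import Defs.
From HB Require Import structures.
From mathcomp Require Import all_boot all_order all_algebra.
From mathcomp Require Import all_classical all_reals all_analysis.
From mathcomp Require Import ring lra.

Set Implicit Arguments.
Unset Strict Implicit.
Unset Printing Implicit Defensive.
Import Order.TTheory GRing.Theory Num.Theory.
Import numFieldNormedType.Exports.
Local Open Scope classical_set_scope.
Local Open Scope ring_scope.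

(** The norm of the stable projection at [x] is read off from pseudo-orbits
    with a single jump.  Let [v] be a tangent vector of norm less than 1 at
    [x].  For small [d > 0], follow the orbit of [x] for negative times, jump at
    time 0 to the point [x_d] of coordinates [x + d v], and follow the orbit of
    [x_d] from then on.  The jump costs at most [d] ([rdist_upper_bound]), so
    some orbit stays within [L d] of this pseudo-orbit; write its point at time
    0 as [x + d w_d].  The vectors [w_d] are bounded and have a cluster point
    [w] as [d] tends to 0.  Each iterate of [f] is differentiable and the
    Riemannian distance is, to first order, the norm of the difference of
    coordinates ([rdist_lower_bound]); dividing by [d] yields
    ([linearized_distance], [shadow_tangent])

      |w - v| <= L,
      |Df^k (w - v)| bounded for k >= 0,    |Df^k w| bounded for k < 0.

    A nonzero unstable component would make the forward orbit of [w - v]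
    unbounded, and a nonzero stable component the backward orbit of [w]
    ([bounded_orbit_component_eq0]).  Hence [w - v] is stable, [w] is unstable,
    and [w - v] is minus the stable component of [v], which therefore has norm
    at most [L].  Every step concerns a fixed [k] and the limit [d -> 0], so
    first-order information at each point of the orbit of [x] is enough.

    The other two bounds are Euclidean geometry.  Two complementary projections
    with one of them of norm at most [L >= 1] both have norm at most [L]
    ([complementary_proj_le]).  For a unit vector [v] in [E^u] and any [w] in
    [E^s], the projection of [v - w] to [E^u] along [E^s] is [v], so
    [1 <= L |v - w|], which bounds the sine of the angle ([sin_angle_ge]).

    The lower bound on the Riemannian distance needs some care.  A curve that
    joins two points near [x] may leave the chart, and its speed is only
    controlled on the pieces where it is C^1.  On a piece inside a small
    coordinate ball the length is bounded below by integrating the derivative of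
    one linear coordinate ([length_chart_ge]); a curve that leaves the ball is
    already long when it is cut at its last entry ([last_entry]). *)

(** * Inner products on coordinate spaces *)

Section InnerProducts.
Variables (R : realType) (n : nat).
Local Notation E := 'rV[R]_n.+1.

Definition bilin_sym (b : E -> E -> R) :=
  (forall a u v w, b (a *: u + v) w = a * b u w + b v w) /\
  (forall u v, b u v = b v u).

Definition posdef (b : E -> E -> R) := forall v, v != 0 -> 0 < b v v.

Definition bnorm (b : E -> E -> R) (v : E) := Num.sqrt (b v v).

Section Algebra.
Context (b : E -> E -> R).
Hypothesis bs : bilin_sym b.

Lemma bilinDl u v w : b (u + v) w = b u w + b v w.
Proof. by have [+ _] := bs => /(_ 1 u v w); rewrite scale1r mul1r. Qed.

Lemma bilin0l w : b 0 w = 0.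
Proof. by have := bilinDl 0 0 w; rewrite addr0 => /eqP; rewrite -subr_eq0 opprD addrA subrr sub0r oppr_eq0 => /eqP. Qed.

Lemma bilinZl a u w : b (a *: u) w = a * b u w.
Proof. by have [+ _] := bs => /(_ a u 0 w); rewrite addr0 bilin0l addr0. Qed.

Lemma bilinDr u v w : b w (u + v) = b w u + b w v.
Proof. by rewrite bs.2 bilinDl !(bs.2 _ w). Qed.

Lemma bilinZr a u w : b w (a *: u) = a * b w u.
Proof. by rewrite bs.2 bilinZl (bs.2 _ w). Qed.

Lemma bilin_suml (I : Type) (r : seq I) (F : I -> E) w :
  b (\sum_(i <- r) F i) w = \sum_(i <- r) b (F i) w.
Proof.
elim: r => [|i r IH]; first by rewrite !big_nil bilin0l.
by rewrite !big_cons bilinDl IH.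
Qed.

Lemma bilin_sumr (I : Type) (r : seq I) (F : I -> E) w :
  b w (\sum_(i <- r) F i) = \sum_(i <- r) b w (F i).
Proof. by rewrite bs.2 bilin_suml; apply: eq_bigr => i _; rewrite bs.2. Qed.

Lemma bilin_coord v : b v v =
  \sum_(i < n.+1) \sum_(j < n.+1)
     v 0 i * v 0 j * b (delta_mx 0 i) (delta_mx 0 j).
Proof.
rewrite {1}(row_sum_delta v) bilin_suml; apply: eq_bigr => i _.
rewrite bilinZl {2}(row_sum_delta v) bilin_sumr mulr_sumr.
by apply: eq_bigr => j _; rewrite bilinZr mulrA.
Qed.

Lemma bilin_sqrD u v : b (u + v) (u + v) = b u u + b u v *+ 2 + b v v.
Proof. by rewrite bilinDl !bilinDr (bs.2 v u) mulr2n !addrA. Qed.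

End Algebra.

Section Norm.
Context (b : E -> E -> R).
Hypotheses (bs : bilin_sym b) (bp : posdef b).

Lemma posdef_ge0 v : 0 <= b v v.
Proof. by have [->|/bp/ltW//] := eqVneq v 0; rewrite bilin0l. Qed.

Lemma bnorm_ge0 v : 0 <= bnorm b v. Proof. exact: sqrtr_ge0. Qed.

Lemma bnorm_sqr v : bnorm b v ^+ 2 = b v v.
Proof. by rewrite sqr_sqrtr ?posdef_ge0. Qed.

Lemma bnorm0 : bnorm b 0 = 0. Proof. by rewrite /bnorm bilin0l// sqrtr0. Qed.

Lemma bnorm_gt0 v : v != 0 -> 0 < bnorm b v.
Proof. by move=> v0; rewrite sqrtr_gt0 bp. Qed.

Lemma bnormZ a v : bnorm b (a *: v) = `|a| * bnorm b v.
Proof.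
by rewrite /bnorm bilinZl// bilinZr// mulrA -expr2 sqrtrM ?sqr_ge0// sqrtr_sqr.
Qed.

Lemma bnormN v : bnorm b (- v) = bnorm b v.
Proof. by rewrite -scaleN1r bnormZ normrN1 mul1r. Qed.

(** Cauchy-Schwarz: expand the square of [|v| u - |u| v]. *)
Lemma bilin_le_norm u v : b u v <= bnorm b u * bnorm b v.
Proof.
have [->|u0] := eqVneq u 0; first by rewrite bilin0l// bnorm0 mul0r.
have [->|v0] := eqVneq v 0.
  by rewrite bs.2 bilin0l// bnorm0 mulr0.
set p := bnorm b u; set q := bnorm b v.
have p0 : 0 < p := bnorm_gt0 u0; have q0 : 0 < q := bnorm_gt0 v0.
have := posdef_ge0 (q *: u + (- p) *: v).
rewrite bilin_sqrD// !bilinZl// !bilinZr// -!bnorm_sqr -/p -/q.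
have -> : q * (q * p ^+ 2) + q * (- p * b u v) *+ 2 + - p * (- p * q ^+ 2) =
  (p * q) *+ 2 * (p * q - b u v) by ring.
by rewrite pmulr_rge0 ?subr_ge0// pmulrn_lgt0 ?mulr_gt0.
Qed.

Lemma bnormD u v : bnorm b (u + v) <= bnorm b u + bnorm b v.
Proof.
rewrite -(@ler_pXn2r _ 2) ?nnegrE ?addr_ge0 ?bnorm_ge0//.
rewrite sqrrD !bnorm_sqr bilin_sqrD// lerD2r lerD2l.
by rewrite lerMn2r/= bilin_le_norm.
Qed.

Lemma coord_le_norm (v : E) i : `|v 0 i| <= `|v|.
Proof.
rewrite [leRHS]mx_normrE (le_trans _ (le_bigmax _ _ (0, i)))//=.
Qed.

Lemma bnorm_upper : exists2 C : R, 0 < C & forall v, bnorm b v <= C * `|v|.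
Proof.
pose S := \sum_(i < n.+1) \sum_(j < n.+1) `|b (delta_mx 0 i) (delta_mx 0 j)|.
have S0 : 0 <= S by apply: sumr_ge0 => i _; apply: sumr_ge0.
exists (Num.sqrt S + 1) => [|v]; first by rewrite ltr_wpDl// sqrtr_ge0.
apply: (@le_trans _ _ (Num.sqrt S * `|v|)); last first.
  by rewrite ler_wpM2r// lerDl.
rewrite -[X in _ <= _ * X]ger0_norm// -sqrtr_sqr -sqrtrM// ler_sqrt ?mulr_ge0 ?sqr_ge0//.
rewrite bilin_coord// mulr_suml; apply: ler_sum => i _.
rewrite mulr_suml; apply: ler_sum => j _.
rewrite (le_trans (ler_norm _))// normrM mulrC ler_wpM2l// normrM expr2.
by rewrite ler_pM// coord_le_norm.
Qed.

Lemma continuous_bnorm : continuous (bnorm b).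
Proof.
have [C C0 bC] := bnorm_upper.
move=> v; apply/(@cvgrPdist_le _ _ _ _ (nbhs_filter v)) => e e0.
have : nbhs v (ball v (e / C)) by apply: nbhsx_ballx; rewrite divr_gt0.
apply: filterS => w; rewrite -ball_normE /= => /ltW.
rewrite ler_pdivlMr// mulrC => vw.
rewrite ler_norml; apply/andP; split.
  rewrite lerNl opprB lerBlDr -{1}(subrK v w) (le_trans (bnormD _ _))//.
  by rewrite lerD2r -bnormN opprB (le_trans (bC _)).
rewrite lerBlDr -{1}(subrK w v) (le_trans (bnormD _ _))//.
by rewrite lerD2r (le_trans (bC _)).
Qed.

Lemma bilin_continuousl w : continuous (fun v => b v w).
Proof.
have [C C0 bC] := bnorm_upper.
pose K := C * (bnorm b w + 1).
have K0 : 0 < K by rewrite mulr_gt0// ltr_wpDl// bnorm_ge0.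
have bK u : b u w <= K * `|u|.
  apply: (le_trans (bilin_le_norm _ _)); rewrite /K mulrAC.
  by rewrite ler_pM ?bnorm_ge0// lerDl.
move=> v; apply/(@cvgrPdist_le _ _ _ _ (nbhs_filter v)) => e e0.
have : nbhs v (ball v (e / K)) by apply: nbhsx_ballx; rewrite divr_gt0.
apply: filterS => u; rewrite -ball_normE /= => /ltW.
rewrite ler_pdivlMr// mulrC => vu.
have bB x y : b x w - b y w = b (x - y) w.
  by rewrite bilinDl// -[- y]scaleN1r bilinZl// mulN1r.
rewrite ler_norml lerNl opprB !bB.
by rewrite (le_trans (bK _))/= ?(le_trans (bK _))// distrC.
Qed.

(** The minimum of the norm over the compact unit sphere of the sup norm. *)
Lemma bnorm_lower : exists2 m : R, 0 < m & forall v, m * `|v| <= bnorm b v.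
Proof.
pose S := [set v : E | `|v| = 1].
have cS : compact S.
  apply: bounded_closed_compact.
    exists 1; split=> // x x1 y Sy; apply: le_trans (ltW x1).
    by rewrite le_eqVlt; apply/orP; left; apply/eqP; exact: Sy.
  apply: (@closed_comp _ _ (fun v : E => `|v|) [set 1]).
    by move=> v _; exact: norm_continuous.
  exact: closed_eq.
have S0 : S !=set0.
  exists (const_mx 1); rewrite /S /= [LHS]mx_normrE.
  apply/le_anti/andP; split.
    by apply: bigmax_le => // i _; rewrite mxE normr1.
  by rewrite (le_trans _ (le_bigmax _ _ (0, 0)))//= mxE normr1.
have [v /set_mem Sv vmin] := EVT_min_rV S0 cS
  (continuous_subspaceT continuous_bnorm).
have v0 : v != 0.
  by apply/eqP => v0; move: Sv; rewrite /S/= v0 normr0 => /esym/eqP; rewrite oner_eq0.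
exists (bnorm b v) => [|w]; first exact: bnorm_gt0.
have [->|w0] := eqVneq w 0; first by rewrite normr0 mulr0 bnorm0.
have nw : 0 < `|w| by rewrite normr_gt0.
(* rescale [w] to the unit sphere *)
rewrite -ler_pdivlMr// mulrC -{1}[`|w|]ger0_norm// -normfV -bnormZ.
by apply: vmin; rewrite inE /S/= normrZ normfV normr_id mulVf ?gt_eqF.
Qed.

End Norm.

(** Pointwise convergence of forms gives uniform relative closeness of the
    norms, because a form is determined by finitely many coefficients and the
    limit norm dominates the sup norm. *)
Lemma bnorm_close (T : Type) (F : set_system T) {FF : Filter F}
    (b : E -> E -> R) (G : T -> E -> E -> R) :
  bilin_sym b -> posdef b -> (forall t, bilin_sym (G t)) ->
  (forall u v, G t u v @[t --> F] --> b u v) ->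
  forall e : R, 0 < e -> e < 1 -> \forall t \near F, forall v,
    (1 - e) * bnorm b v <= bnorm (G t) v <= (1 + e) * bnorm b v.
Proof.
move=> bs bp Gs Gb e e0 e1.
have [m m0 bm] := bnorm_lower bs bp.
pose N : R := n.+1%:R.
have N0 : 0 < N by rewrite ltr0n.
pose h := e * m ^+ 2 / (N * N).
have h0 : 0 < h by rewrite divr_gt0 ?mulr_gt0 ?exprn_gt0.
have key : \forall t \near F, forall i j : 'I_n.+1,
    `|G t (delta_mx 0 i) (delta_mx 0 j) - b (delta_mx 0 i) (delta_mx 0 j)| <= h.
  apply: filter_forall => i; apply: filter_forall => j.
  have /cvgrPdist_le/(_ _ h0) := Gb (delta_mx 0 i) (delta_mx 0 j).
  by apply: filterS => t; rewrite distrC.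
apply: filterS key => t ht v.
have dG : `|G t v v - b v v| <= e * b v v.
  rewrite !bilin_coord// -sumrB.
  under eq_bigr do rewrite -sumrB.
  apply: (@le_trans _ _ (\sum_(i < n.+1) \sum_(j < n.+1) (`|v| ^+ 2 * h))).
    apply: (le_trans (ler_norm_sum _ _ _)); apply: ler_sum => i _.
    apply: (le_trans (ler_norm_sum _ _ _)); apply: ler_sum => j _.
    rewrite -mulrBr normrM ler_pM// normrM expr2 ler_pM// coord_le_norm//.
  rewrite !sumr_const !card_ord -!mulrnA -mulr_natr natrM -/N -bilin_coord//.
  have -> : `|v| ^+ 2 * h * (N * N) = e * (m * `|v|) ^+ 2.
    by rewrite /h; field; rewrite gt_eqF.
  apply: ler_wpM2l; first exact: ltW.
  rewrite -bnorm_sqr//.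
  by rewrite ler_pXn2r ?nnegrE ?mulr_ge0 ?(ltW m0) ?bnorm_ge0.
have bv0 := posdef_ge0 bs bp v.
move: dG; rewrite ler_distl => /andP[dG1 dG2].
(* (1 - e)^2 <= 1 - e and 1 + e <= (1 + e)^2 turn the additive bound on
   squares into a multiplicative bound on norms *)
have lo : ((1 - e) * bnorm b v) ^+ 2 <= G t v v.
  rewrite exprMn bnorm_sqr// (le_trans _ dG1)// -[X in _ <= X - _]mul1r -mulrBl.
  by rewrite ler_wpM2r// expr2 ger_pMl ?subr_gt0// gerBl ltW.
have up : G t v v <= ((1 + e) * bnorm b v) ^+ 2.
  rewrite exprMn bnorm_sqr// (le_trans dG2)// -[X in X + _]mul1r -mulrDl.
  by rewrite ler_wpM2r// expr2 ler_peMl ?addr_ge0 ?(ltW e0)// lerDl ltW.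
have Gv0 : 0 <= G t v v by exact: le_trans (sqr_ge0 _) lo.
have lo0 : 0 <= (1 - e) * bnorm b v by rewrite mulr_ge0 ?subr_ge0 ?(ltW e1) ?bnorm_ge0.
have up0 : 0 <= (1 + e) * bnorm b v by rewrite mulr_ge0 ?addr_ge0 ?(ltW e0) ?bnorm_ge0.
by rewrite -{1}(ger0_norm lo0) -{1}sqrtr_sqr -[X in _ <= X <= _]/(Num.sqrt _) -(ger0_norm up0) -sqrtr_sqr !ler_sqrt ?lo ?up ?sqr_ge0.
Qed.

End InnerProducts.
(** * Differentials *)

Section Differentials.
Variables (R : realType) (V W : normedModType R).

Lemma differentiable_estimate (f : V -> W) x : differentiable f x ->
  forall e : R, 0 < e ->
    \forall h \near (0 : V), `|f (h + x) - f x - 'd f x h| <= e * `|h|.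
Proof.
move=> /diff_locally /eqaddoP fx e /fx; apply: filterS => h /=.
by rewrite !fctE/= opprD addrA.
Qed.

Lemma differentiable_by_estimate (f : V -> W) (df : {linear V -> W}) x :
  continuous df ->
  (forall e : R, 0 < e ->
    \forall h \near (0 : V), `|f (h + x) - f x - df h| <= e * `|h|) ->
  differentiable f x /\ 'd f x = df :> (V -> W).
Proof.
move=> cdf fx.
have fo : f \o shift x = cst (f x) + df +o_ 0 id.
  apply/eqaddoP => e /fx; apply: filterS => h /=.
  by rewrite !fctE/= opprD addrA.
have dfE := diff_unique cdf fo; split => //.
by apply/diff_locallyP; rewrite dfE.
Qed.

(** Chart expressions of composites agree only near the base point, so
    differentials have to be transported along local equality. *)
Lemma differentiable_near_eq (f g : V -> W) x :
  (\forall y \near x, f y = g y) -> differentiable f x ->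
  differentiable g x /\ 'd g x = 'd f x :> (V -> W).
Proof.
move=> fg df; apply: differentiable_by_estimate; first exact: diff_continuous.
move=> e e0; have fgx := nbhs_singleton fg.
have fg0 : \forall h \near (0 : V), f (h + x) = g (h + x).
  by move: fg; rewrite (near_shift 0 x); apply: filterS => h /=; rewrite subr0.
have := differentiable_estimate df e0.
by apply: filterS2 fg0 => h -> ; rewrite fgx.
Qed.

End Differentials.

Lemma open_nbhs_of {T : topologicalType} (A : set T) x :
  open A -> A x -> nbhs x A.
Proof. by move=> oA Ax; apply: open_nbhs_nbhs. Qed.

Lemma continuous_in_at {T U : topologicalType} (A : set T) (f : T -> U) x :
  {in A, continuous f} -> A x -> {for x, continuous f}.
Proof. by move=> cf Ax; apply: cf; rewrite inE. Qed.

(** * Maps between manifolds in charts *)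

Section Charts.
Variables (R : realType) (n : nat) (M : topologicalType) (X : manifold R n M).
Local Notation E := 'rV[R]_n.+1.
Implicit Types (c : chart R n M) (x y : M) (h : M -> M).

Lemma fwd_near c x (A : set E) : chart_dom c x -> nbhs (fwd c x) A ->
  \forall y \near x, chart_dom c y /\ A (fwd c y).
Proof.
move=> cx Ax; have cf := continuous_in_at (fwd_continuous (c:=c)) cx.
apply: filterS2 (open_nbhs_of (chart_dom_open c) cx) (cf _ Ax).
by move=> y.
Qed.

Lemma chart_cod_nbhs c p : chart_cod c p -> nbhs p (chart_cod c).
Proof. by move=> cp; apply: open_nbhs_of cp; exact: chart_cod_open. Qed.

Lemma bwd_near c p (A : set M) : chart_cod c p -> nbhs (bwd c p) A ->
  \forall q \near p, chart_cod c q /\ A (bwd c q).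
Proof.
move=> cp Ap; have cf := continuous_in_at (bwd_continuous (c:=c)) cp.
apply: filterS2 (chart_cod_nbhs cp) (cf _ Ap).
by move=> q.
Qed.

Definition local_map h c c' : E -> E := fwd c' \o h \o bwd c.

Lemma transition_differentiable c1 c2 x : atlas X c1 -> atlas X c2 ->
  chart_dom c1 x -> chart_dom c2 x ->
  differentiable (fwd c2 \o bwd c1) (fwd c1 x).
Proof.
move=> a1 a2 x1 x2; have [+ _] := transition_smooth a1 a2 1%N; apply.
by split; [exact: fwd_cod|rewrite /preimage/= fwdK].
Qed.

(** First-order regularity at one point, in all charts: unlike the global C^1
    condition it passes to iterates by the chain rule alone. *)
Definition smooth_at h x := {for x, continuous h} /\
  forall c c', atlas X c -> atlas X c' -> chart_dom c x -> chart_dom c' (h x) ->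
    differentiable (local_map h c c') (fwd c x).

Lemma C1_smooth_at h x : C1_map X h -> smooth_at h x.
Proof.
move=> [ch dh]; split; first exact: ch.
move=> c c' ac ac' cx cx'; have [+ _] := dh c c' ac ac'; apply.
by split; [exact: fwd_cod|rewrite /preimage/= fwdK].
Qed.

(** Away from the base point, [h] may leave the intermediate chart, where the
    maps of that chart are no longer inverse to each other. *)
Lemma local_map_comp_near h k c c1 c' x : {for x, continuous h} ->
  chart_dom c x -> chart_dom c1 (h x) ->
  \forall p \near fwd c x,
    (local_map k c1 c' \o local_map h c c1) p = local_map (k \o h) c c' p.
Proof.
move=> ch cx cx1.
have cp : chart_cod c (fwd c x) by exact: fwd_cod.
have : nbhs (bwd c (fwd c x)) (h @^-1` chart_dom c1).
  by rewrite fwdK//; apply: ch; apply: open_nbhs_of cx1; exact: chart_dom_open.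
move=> /(bwd_near cp); apply: filterS => p [pc ph].
by rewrite /local_map/= fwdK.
Qed.

Lemma smooth_at_comp h k x : smooth_at h x -> smooth_at k (h x) ->
  smooth_at (k \o h) x.
Proof.
move=> [ch dh] [ck dk]; split; first exact: continuous_comp.
move=> c c' ac ac' cx cx'.
pose c1 := chart_at X (h x).
have ac1 : atlas X c1 by exact: chart_at_atlas.
have cx1 : chart_dom c1 (h x) by exact: chart_at_dom.
have nr := local_map_comp_near k c' ch cx cx1.
apply: (differentiable_near_eq nr _).1.
apply: differentiable_comp; first exact: dh.
by rewrite /local_map/= fwdK//; exact: dk.
Qed.

Lemma tangent_map_comp h k x : smooth_at h x -> smooth_at k (h x) ->
  forall v, tangent_map X (k \o h) x v = tangent_map X k (h x) (tangent_map X h x v).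
Proof.
move=> [ch dh] [ck dk] v.
pose c := chart_at X x; pose c1 := chart_at X (h x).
pose c' := chart_at X (k (h x)).
have ac1 : atlas X c1 by exact: chart_at_atlas.
have cx1 : chart_dom c1 (h x) by exact: chart_at_dom.
have cx : chart_dom c x by exact: chart_at_dom.
have dh1 : differentiable (local_map h c c1) (fwd c x).
  by apply: dh => //; exact: chart_at_atlas.
have dk1 : differentiable (local_map k c1 c') (local_map h c c1 (fwd c x)).
  have -> : local_map h c c1 (fwd c x) = fwd c1 (h x) by rewrite /local_map/= fwdK.
  by apply: dk => //; [exact: chart_at_atlas|exact: chart_at_dom].
have nr := local_map_comp_near k c' ch cx cx1.
have [_ eqd] := differentiable_near_eq nr (differentiable_comp dh1 dk1).
have := congr1 (fun f => f v) (etrans eqd (diff_comp dh1 dk1)).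
have -> : local_map h c c1 (fwd c x) = fwd c1 (h x) by rewrite /local_map/= fwdK.
exact.
Qed.

Lemma tangent_map_id x v : tangent_map X id x v = v.
Proof.
pose c := chart_at X x.
have cp : chart_cod c (fwd c x) by apply: fwd_cod; exact: chart_at_dom.
have nr : \forall p \near fwd c x, id p = (fwd c \o id \o bwd c) p.
  move: (chart_cod_nbhs cp); apply: filterS => p pc.
  by rewrite /= bwdK.
have di : differentiable (@idfun E) (fwd c x) by [].
have [_] := differentiable_near_eq nr di.
by move=> /(congr1 (fun f => f v)); rewrite /tangent_map -/c => ->; rewrite diff_val.
Qed.

Lemma smooth_at_id x : smooth_at id x.
Proof.
split; first exact: cvg_id.
by move=> c c' ac ac' cx cx'; exact: transition_differentiable.
Qed.

Lemma smooth_at_iter h x k : C1_map X h -> smooth_at (iter k h) x.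
Proof.
move=> h1; elim: k => [|k IH]; first exact: smooth_at_id.
by apply: (@smooth_at_comp (iter k h) h) => //; exact: C1_smooth_at.
Qed.

Lemma tangent_map_iterS h x k v : C1_map X h ->
  tangent_map X (iter k.+1 h) x v =
  tangent_map X h (iter k h x) (tangent_map X (iter k h) x v).
Proof.
move=> h1; apply: (@tangent_map_comp (iter k h) h); first exact: smooth_at_iter.
exact: C1_smooth_at.
Qed.

Lemma tangent_map_cancel h k x v : cancel h k ->
  smooth_at h x -> smooth_at k (h x) ->
  tangent_map X k (h x) (tangent_map X h x v) = v.
Proof.
move=> hk sh sk; rewrite -tangent_map_comp//.
by rewrite (_ : k \o h = id) ?tangent_map_id//; apply/funext => y /=; rewrite hk.
Qed.

Lemma of_chart_at x v : of_chart X (chart_at X x) x v = v.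
Proof. exact: tangent_map_id. Qed.

End Charts.
(** * The metric and the velocity of a curve in a chart *)

Section Velocity.
Variables (R : realType) (n : nat) (M : topologicalType) (X : manifold R n M).
Variable g : riemannian_metric X.
Local Notation E := 'rV[R]_n.+1.
Implicit Types (c : chart R n M) (x y : M) (gamma sigma : R -> M).

Lemma inner_bilin x : bilin_sym (inner g x).
Proof. by split; [exact: inner_linear|exact: inner_sym]. Qed.

Lemma inner_pos x : posdef (inner g x).
Proof. exact: inner_posdef. Qed.

(** The metric tensor [g_ij] of a chart, as a form depending on the point. *)
Definition chart_inner c (p v w : E) : R :=
  inner g (bwd c p) (of_chart X c (bwd c p) v) (of_chart X c (bwd c p) w).

Lemma chart_inner_bilin c p : bilin_sym (chart_inner c p).
Proof.
split=> [a u v w|u v]; last exact: inner_sym.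
by rewrite /chart_inner linearP inner_linear.
Qed.

Lemma chart_inner_cvg x v w : let c := chart_at X x in
  chart_inner c p v w @[p --> fwd c x] --> inner g x v w.
Proof.
move=> c.
have cx : chart_dom c x by exact: chart_at_dom.
have E0 : chart_inner c (fwd c x) v w = inner g x v w.
  by rewrite /chart_inner (fwdK cx) /c !of_chart_at.
rewrite -E0; have := @inner_smooth _ _ _ _ g c (chart_at_atlas X x) v w 0%N.
by apply; rewrite inE; exact: fwd_cod.
Qed.

(** Continuity of the metric tensor at the base point of the preferred chart,
    where it is the inner product of the tangent space itself. *)
Lemma metric_near x (e : R) : 0 < e -> e < 1 -> let c := chart_at X x in
  \forall p \near fwd c x, chart_cod c p /\ forall v,
    (1 - e) * tnorm g x v <= bnorm (chart_inner c p) v <= (1 + e) * tnorm g x v.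
Proof.
move=> e0 e1 c.
have cx : chart_cod c (fwd c x) by apply: fwd_cod; exact: chart_at_dom.
have nr := @bnorm_close R n _ _ (nbhs_filter (fwd c x)) (inner g x) (chart_inner c)
  (inner_bilin x) (@inner_pos x) (chart_inner_bilin c) (@chart_inner_cvg x) e e0 e1.
by apply: filterS2 (chart_cod_nbhs cx) nr => p.
Qed.

Lemma velocity_near_eq gamma sigma (t : R) :
  (\forall s \near t, gamma s = sigma s) -> velocity X gamma t = velocity X sigma t.
Proof.
move=> gs; rewrite /velocity -(nbhs_singleton gs) !derive1E.
by apply: near_eq_derive; apply: filterS gs => s /= ->.
Qed.

(** The velocity is defined in the preferred chart of the moving point
    [gamma t]; the chain rule re-expresses it in a fixed chart. *)
Lemma velocity_chart c gamma (t : R) : atlas X c -> {for t, continuous gamma} ->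
  chart_dom c (gamma t) ->
  differentiable (fwd c \o gamma : R^o -> E) t ->
  velocity X gamma t = of_chart X c (gamma t) ('d (fwd c \o gamma : R^o -> _) t 1).
Proof.
move=> ac cg ct dg; set c0 := chart_at X (gamma t).
have d0 : chart_dom c0 (gamma t) by exact: chart_at_dom.
have dT : differentiable (fwd c0 \o bwd c) ((fwd c \o gamma) t).
  exact: transition_differentiable ac (chart_at_atlas X _) ct d0.
have nr : \forall s \near (t : R^o), ((fwd c0 \o bwd c) \o (fwd c \o gamma)) s = (fwd c0 \o gamma) s.
  have cs : nbhs t (gamma @^-1` chart_dom c).
    exact: cg (open_nbhs_of (chart_dom_open c) ct).
  by apply: filterS cs => s cs /=; rewrite fwdK.
have [df eqd] := differentiable_near_eq nr (differentiable_comp dg dT).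
rewrite /velocity -/c0 derive1E'; last exact: df.
by have := congr1 (fun f => f 1) (etrans eqd (diff_comp dg dT)).
Qed.

Lemma tnorm_velocity c gamma (t : R) : atlas X c -> {for t, continuous gamma} ->
  chart_dom c (gamma t) ->
  differentiable (fwd c \o gamma : R^o -> E) t ->
  tnorm g (gamma t) (velocity X gamma t) =
  bnorm (chart_inner c (fwd c (gamma t))) ('d (fwd c \o gamma : R^o -> _) t 1).
Proof.
by move=> ac cg ct dg; rewrite (velocity_chart ac cg ct dg) /bnorm /chart_inner fwdK.
Qed.

End Velocity.
(** * Lower integrals *)

Section LowerIntegral.
Context d (T : measurableType d) (R : realType).
Variable mu : {measure set T -> \bar R}.
Implicit Types (A B D : set T) (f : T -> \bar R).
Local Open Scope ereal_scope.

Import HBNNSimple.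

Lemma ge0_integral_sup D f : (forall x, D x -> 0 <= f x) ->
  \int[mu]_(x in D) f x = ereal_sup [set sintegral mu h |
    h in [set h : {nnsfun T >-> R} | forall x, (h x)%:E <= (f \_ D) x]].
Proof. by move=> f0; rewrite ge0_integralE. Qed.

(** The integral of a nonnegative function is a supremum over simple functions
    below it, hence monotone for all nonnegative functions.  This form spares
    the measurability of the speed of a piecewise C^1 curve. *)
Lemma ge0_le_integral_lower D f1 f2 : (forall x, D x -> 0 <= f1 x) ->
  (forall x, D x -> f1 x <= f2 x) ->
  \int[mu]_(x in D) f1 x <= \int[mu]_(x in D) f2 x.
Proof.
move=> f10 f12.
have f20 x : D x -> 0 <= f2 x by move=> Dx; apply: le_trans (f12 x Dx); exact: f10.
rewrite !ge0_integral_sup//; apply: ge_ereal_sup => _ [h hf <-].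
apply: ereal_sup_ubound; exists h => // x; apply: le_trans (hf x) _.
by rewrite /patch; case: ifPn => // /set_mem /f12.
Qed.

(** Superadditivity over disjoint sets: simple functions below [f] on [A] and
    on [B] add up to a simple function below [f] on [D].  Lower bounds for the
    length of the pieces of a curve are glued with it. *)
Lemma integral_setU_le A B D f : (forall x, D x -> 0 <= f x) ->
  A `&` B = set0 -> A `<=` D -> B `<=` D ->
  \int[mu]_(x in A) f x + \int[mu]_(x in B) f x <= \int[mu]_(x in D) f x.
Proof.
move=> f0 AB AD BD.
have fA x : A x -> 0 <= f x by move=> /AD/f0.
have fB x : B x -> 0 <= f x by move=> /BD/f0.
have I0 : 0 <= \int[mu]_(x in D) f x by exact: integral_ge0.
have [->|] := eqVneq (\int[mu]_(x in D) f x) +oo; first by rewrite leey.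
rewrite -ltey => Ioo.
have Ifin : \int[mu]_(x in D) f x \is a fin_num by rewrite ge0_fin_numE.
have key (h1 h2 : {nnsfun T >-> R}) :
    (forall x, (h1 x)%:E <= (f \_ A) x) -> (forall x, (h2 x)%:E <= (f \_ B) x) ->
    sintegral mu h1 + sintegral mu h2 <= \int[mu]_(x in D) f x.
  move=> h1f h2f; rewrite -sintegralD [leRHS]ge0_integral_sup//.
  apply: ereal_sup_ubound; exists (add_nnsfun h1 h2) => // x /=.
  rewrite EFinD; apply: (le_trans (leeD (h1f x) (h2f x))); rewrite /patch.
  case: ifPn => [/set_mem Ax|_]; case: ifPn => [/set_mem Bx|_].
  - by have : (A `&` B) x by []; rewrite AB.
  - by rewrite adde0 mem_set//; exact: AD.
  - by rewrite add0e mem_set//; exact: BD.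
  - by rewrite adde0; case: ifPn => // /set_mem /f0.
have fins (h : {nnsfun T >-> R}) : sintegral mu h <= \int[mu]_(x in D) f x ->
    sintegral mu h \is a fin_num.
  by move=> h1; rewrite ge0_fin_numE ?sintegral_ge0// (le_lt_trans h1).
have IA0 : 0 <= \int[mu]_(x in A) f x by exact: integral_ge0.
have IB0 : 0 <= \int[mu]_(x in B) f x by exact: integral_ge0.
(* pass to the supremum over one of the two simple functions at a time *)
have finA (h1 : {nnsfun T >-> R}) : (forall x, (h1 x)%:E <= (f \_ A) x) ->
    \int[mu]_(x in B) f x <= \int[mu]_(x in D) f x - sintegral mu h1.
  move=> h1f; rewrite ge0_integral_sup//; apply: ge_ereal_sup => _ [h2 h2f <-].
  have h12 := key h1 h2 h1f h2f.
  rewrite leeBrDr ?fins ?(le_trans _ h12) ?leeDl ?sintegral_ge0//.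
  by rewrite addeC.
have IBfin : \int[mu]_(x in B) f x \is a fin_num.
  rewrite ge0_fin_numE//; apply: (le_lt_trans (finA (@nnsfun0 _ T R) _)).
    by move=> x; rewrite /patch; case: ifPn => // /set_mem /fA.
  by rewrite sintegral0 sube0.
rewrite -leeBrDr// ge0_integral_sup//; apply: ge_ereal_sup => _ [h1 h1f <-].
rewrite leeBrDr// addeC -leeBrDr ?finA//.
apply: fins; apply: le_trans (key h1 (@nnsfun0 _ T R) h1f _).
  by rewrite sintegral0 adde0.
by move=> x; rewrite /patch; case: ifPn => // /set_mem /fB.
Qed.

Lemma integral_subset_le A D f : (forall x, D x -> 0 <= f x) -> A `<=` D ->
  \int[mu]_(x in A) f x <= \int[mu]_(x in D) f x.
Proof.
move=> f0 AD; have := @integral_setU_le A set0 D f f0 (setI0 _) AD (sub0set _).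
have -> : \int[mu]_(x in set0) f x = 0 by apply: integral0_eq.
by rewrite adde0.
Qed.

End LowerIntegral.

(** The interval is open because the speed of a piecewise C^1 curve carries no
    information at the break points. *)
Lemma FTC_lower_bound (R : realType) (F F' : R -> R) (h : R -> \bar R) (a b : R) :
  a < b -> (forall t, a <= t <= b -> is_derive t (1:R) F (F' t)) ->
  (forall t, a <= t <= b -> {for t, continuous F'}) ->
  (forall t, a < t < b -> (0 <= h t)%E) ->
  (forall t, a < t < b -> ((F' t)%:E <= h t)%E) ->
  ((F b - F a)%:E <= \int[lebesgue_measure]_(t in `]a, b[) h t)%E.
Proof.
move=> ab dF cF' h0 F'h.
have dF1 t : a <= t <= b -> derivable F t 1 by move=> /dF d; exact: ex_derive.
have cF t : a <= t <= b -> {for t, continuous F}.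
  by move=> /dF1 d; apply: differentiable_continuous; exact/derivable1_diffP.
have wc : {within `[a, b], continuous F'}.
  apply: continuous_in_subspaceT => t /set_mem /=; rewrite in_itv/=; exact: cF'.
have LR : derivable_oo_LRcontinuous F a b.
  split.
  - by move=> t; rewrite in_itv/= => /andP[ta tb]; apply: dF1; rewrite !ltW.
  - by apply: cvg_at_right_filter; apply: cF; rewrite lexx ltW.
  - by apply: cvg_at_left_filter; apply: cF; rewrite lexx ltW.
have F'E : {in `]a, b[, F^`()%classic =1 F'}.
  move=> t; rewrite in_itv/= => /andP[ta tb]; rewrite derive1E.
  have := dF t; rewrite !ltW// => /(_ isT) d.
  exact: derive_val.
have /integrableP[mF _] := continuous_compact_integrable (@segment_compact _ a b) wc.
have {}mF := measurable_funS (measurable_itv _) (@subset_itv_oo_cc _ _ a b) mF.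
rewrite EFinB -(continuous_FTC2 ab wc LR F'E).
rewrite (@integral_itv_bndoo _ a b (EFin \o F') true false mF).
rewrite integralE; apply: (@le_trans _ _ (\int[lebesgue_measure]_(t in `]a, b[) ((EFin \o F')^\+ t))%E).
  by rewrite -[leRHS]adde0 leeD2l// oppe_le0; exact: integral_ge0.
apply: ge0_le_integral_lower => // t; rewrite /= in_itv/= => tab.
by rewrite funeposE ge_max F'h// h0.
Qed.
(** * Lower bounds for the length of curves *)

Section LowerBound.
Variables (R : realType) (n : nat) (M : topologicalType) (X : manifold R n M).
Variable g : riemannian_metric X.
Local Notation E := 'rV[R]_n.+1.
Implicit Types (c : chart R n M) (x y : M) (gamma sigma : R -> M).

Definition speed gamma (t : R) : \bar R :=
  (tnorm g (gamma t) (velocity X gamma t))%:E.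

Lemma speed_ge0 gamma t : (0 <= speed gamma t)%E.
Proof. by rewrite lee_fin sqrtr_ge0. Qed.

Lemma speed_near_eq gamma sigma (t : R) :
  (\forall s \near t, gamma s = sigma s) -> speed gamma t = speed sigma t.
Proof.
by move=> gs; rewrite /speed (velocity_near_eq X gs) (nbhs_singleton gs).
Qed.

Lemma C1_curve_chart sigma c (t : R) : C1_curve X sigma -> atlas X c ->
  chart_dom c (sigma t) ->
  differentiable (fwd c \o sigma : R^o -> E) t /\
  {for t, continuous (fun s : R^o => 'd (fwd c \o sigma : R^o -> E) s (1 : R^o))}.
Proof.
move=> [cs ds] ac ct; have [d1 d2] := ds c ac.
split; first exact: d1.
by apply: (d2 1); rewrite inE.
Qed.

(** Project the curve orthogonally, for [b], to the line through its two end
    points: by Cauchy-Schwarz the projected coordinate moves no faster than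
    the curve, and it moves from one end of the chord to the other. *)
Lemma length_chart_ge sigma c (b : E -> E -> R) (k s t : R) :
  bilin_sym b -> posdef b -> 0 <= k -> C1_curve X sigma -> atlas X c -> s < t ->
  (forall z, s <= z <= t -> chart_dom c (sigma z)) ->
  (forall z, s <= z <= t -> forall v,
    k * bnorm b v <= bnorm (chart_inner g c (fwd c (sigma z))) v) ->
  ((k * bnorm b (fwd c (sigma t) - fwd c (sigma s)))%:E <=
    \int[lebesgue_measure]_(z in `]s, t[) speed sigma z)%E.
Proof.
move=> bs bp k0 sC1 ac st cdom cmp.
set e := fwd c (sigma t) - fwd c (sigma s).
have [e0|e0] := eqVneq e 0.
  by rewrite e0 bnorm0// mulr0; apply: integral_ge0 => z _; exact: speed_ge0.
pose N := bnorm b e.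
have N0 : 0 < N by exact: bnorm_gt0.
pose l0 (v : E) : R^o := k / N * b v e.
have l0lin : linear l0.
  move=> a u v; rewrite /l0 bs.1 mulrDr; congr (_ + _).
  by rewrite mulrCA.
pose l : {linear E -> R^o} := HB.pack l0 (GRing.isLinear.Build _ _ _ _ l0 l0lin).
have cl : continuous l.
  move=> v; exact: (cvgM (cvg_cst (k / N)) (@bilin_continuousl R n b bs bp e v)).
pose u : R^o -> E := fwd c \o sigma.
pose F : R -> R := l \o u.
pose F' : R -> R := fun z => l ('d u z (1 : R^o)).
have du z : s <= z <= t -> differentiable u z.
  by move=> /cdom cz; exact: (C1_curve_chart sC1 ac cz).1.
have dl (v : E) : differentiable l v by exact: linear_differentiable.
have -> : k * bnorm b e = F t - F s.
  rewrite /F -[RHS]/(l (u t) - l (u s)) -linearB -/e.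
  rewrite -[RHS]/(k / N * b e e) -bnorm_sqr// -/N expr2.
  by field; rewrite gt_eqF.
apply: (@FTC_lower_bound R F F') => //.
- move=> z stz; apply: DeriveDef.
    by apply: diff_derivable; apply: differentiable_comp; [exact: du|exact: dl].
  rewrite deriveE; last by apply: differentiable_comp; [exact: du|exact: dl].
  rewrite (diff_comp (du z stz) (dl _)).
  by rewrite (diff_lin _ cl).
- move=> z /cdom cz; have [_ cdu] := C1_curve_chart sC1 ac cz.
  apply: (@continuous_comp R^o E R^o (fun z => 'd u z (1 : R^o)) l) => //.
  exact: cl.
- by move=> z _; exact: speed_ge0.
- move=> z /andP[sz zt].
  have stz : s <= z <= t by rewrite !ltW.
  rewrite /speed lee_fin (tnorm_velocity _ ac _ (cdom z stz) (du z stz)); last first.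
    exact: sC1.1.
  apply: le_trans (cmp z stz _).
  rewrite -[F' z]/(k / N * b ('d u z (1 : R^o)) e).
  rewrite -mulrA ler_wpM2l// mulrC ler_pdivrMr//.
  exact: bilin_le_norm.
Qed.

End LowerBound.
(** * Curves that leave a coordinate ball *)

Section FirstExit.
Variables (R : realType) (n : nat) (M : topologicalType) (X : manifold R n M).
Local Notation E := 'rV[R]_n.+1.
Implicit Types (c : chart R n M) (sigma : R -> M).

Definition chart_ball c (p : E) (r : R) : set M :=
  [set y | chart_dom c y /\ `|fwd c y - p| < r].

Lemma chart_ball_open c p r : open (chart_ball c p r).
Proof.
rewrite openE => y [cy yr]; rewrite /interior.
have : nbhs (fwd c y) (ball p r).
  apply: open_nbhs_of; first exact: ball_open.
  by rewrite -ball_normE /= distrC.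
move=> /(fwd_near cy); apply: filterS => z [cz].
by rewrite -ball_normE /= distrC.
Qed.

Lemma compact_norm_ball (p : E) (r : R) : compact [set q : E | `|q - p| <= r].
Proof.
apply: bounded_closed_compact.
  exists (r + `|p|); split=> [|x rx q qr]; first exact: num_real.
  apply: le_trans (ltW rx); rewrite -lerBlDr.
  exact: le_trans (lerB_dist _ _) qr.
apply: (@closed_comp _ _ (fun q : E => `|q - p|) [set x | x <= r]).
  move=> q _; apply: (@continuous_comp _ _ _ (fun q : E => q - p) (fun z : E => `|z|)).
    exact: (cvgB (@cvg_id _ (nbhs q)) (cvg_cst p)).
  exact: norm_continuous.
exact: closed_le.
Qed.

(** Compact subsets of the Hausdorff space [M] are closed.  This prevents a
    curve from leaving the chart without crossing the sphere of radius [r]. *)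
Lemma chart_closed_ball_closed c p r : [set q | `|q - p| <= r] `<=` chart_cod c ->
  closed (bwd c @` [set q | `|q - p| <= r]).
Proof.
move=> sub; apply: compact_closed; first exact: manifold_hausdorff X.
apply: continuous_compact; last exact: compact_norm_ball.
apply: continuous_in_subspaceT => q /set_mem/sub qc.
exact: continuous_in_at (bwd_continuous (c:=c)) qc.
Qed.

(** The exit time is the minimum of the compact set of times outside the open
    ball; the limit point there still lies in the image of the closed ball. *)
Lemma first_exit sigma c p r (a b : R) : continuous sigma -> a <= b ->
  [set q | `|q - p| <= r] `<=` chart_cod c -> chart_ball c p r (sigma a) ->
  (forall t, a <= t <= b -> chart_ball c p r (sigma t)) \/
  (exists2 t1, a < t1 <= b & [/\ chart_dom c (sigma t1),
     `|fwd c (sigma t1) - p| = r &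
     forall t, a <= t < t1 -> chart_ball c p r (sigma t)]).
Proof.
move=> cs ab sub sa.
pose S := `[a, b]%classic `&` sigma @^-1` (~` chart_ball c p r).
have [S0|] := eqVneq S set0.
  left => t tab; apply: contrapT => nt.
  by have : S t by []; rewrite S0.
move=> /set0P S0; right.
have cS : compact S.
  apply: (@subclosed_compact _ _ `[a, b]%classic); last 2 first.
  - exact: segment_compact.
  - exact: subIsetl.
  apply: closedI; first exact: itv_closed.
  apply: closed_comp; first by move=> t _; exact: cs.
  by apply: open_closedC; exact: chart_ball_open.
have cid : continuous (@idfun R) by move=> t; exact: cvg_id.
have [t1 /set_mem[/=]] := compact_EVT_min S0 cS (continuous_subspaceT cid).
rewrite in_itv/= => /andP[at1 t1b] nt1 tmin.
have before t : a <= t < t1 -> chart_ball c p r (sigma t).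
  move=> /andP[ta tt1]; apply: contrapT => nt.
  have : t \in S.
    rewrite inE; split => //=; rewrite in_itv/= ta/=.
    exact: le_trans (ltW tt1) t1b.
  by move=> /tmin; rewrite leNgt tt1.
have at1' : a < t1.
  by rewrite lt_neqAle at1 andbT; apply/eqP => at1E; apply: nt1; rewrite -at1E.
(* otherwise [sigma] would avoid the closed ball just before [t1] as well *)
have [q /= qr qs] : (bwd c @` [set q | `|q - p| <= r]) (sigma t1).
  apply: contrapT => nK.
  have := chart_closed_ball_closed sub; rewrite -openC => oK.
  have nb : nbhs t1 (sigma @^-1` (~` (bwd c @` [set q | `|q - p| <= r]))).
    by apply: cs; exact: open_nbhs_of oK nK.
  have /nbhs_ballP[e /= e0 eball] := nb.
  pose t := Num.max a (t1 - e / 2).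
  have tt1 : t < t1 by rewrite gt_max at1' ltrBlDr ltrDl divr_gt0.
  have ta : a <= t by rewrite le_max lexx.
  have [cd tr] : chart_ball c p r (sigma t) by apply: before; rewrite ta.
  apply: (eball t).
    rewrite -ball_normE /= ger0_norm ?subr_ge0 ?(ltW tt1)// ltrBlDr -ltrBlDl.
    by rewrite lt_max; apply/orP; right; rewrite ltrD2l ltrN2 ltr_pdivrMr// ltr_pMr// ltr1n.
  by exists (fwd c (sigma t)); [exact: ltW|rewrite fwdK].
exists t1; first by rewrite at1' t1b.
have cq := sub q qr.
have cd : chart_dom c (sigma t1) by rewrite -qs; exact: bwd_dom.
split => //; apply/eqP; rewrite eq_le.
rewrite -{1}qs bwdK// qr/= leNgt; apply/negP => lt.
by apply: nt1; split.
Qed.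

(** Time reversal of [first_exit]. *)
Lemma last_entry sigma c p r (a b : R) : continuous sigma -> a <= b ->
  [set q | `|q - p| <= r] `<=` chart_cod c -> chart_ball c p r (sigma b) ->
  (forall t, a <= t <= b -> chart_ball c p r (sigma t)) \/
  (exists2 t1, a <= t1 < b & [/\ chart_dom c (sigma t1),
     `|fwd c (sigma t1) - p| = r &
     forall t, t1 < t <= b -> chart_ball c p r (sigma t)]).
Proof.
move=> cs ab sub sb; pose rho t := sigma (a + b - t).
have crho : continuous rho.
  move=> t; apply: (@continuous_comp _ _ _ (fun t => a + b - t) sigma); last exact: cs.
  by apply: cvgB; [exact: cvg_cst|exact: cvg_id].
have rhoE t : sigma t = rho (a + b - t) by rewrite /rho opprB addrC subrK.
have rhoa : chart_ball c p r (rho a) by rewrite /rho addrAC subrr add0r.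
have [inside|[t1 /andP[at1 t1b] [cd t1r before]]] := first_exit crho ab sub rhoa.
  left => t /andP[ta tb]; rewrite rhoE; apply: inside; apply/andP; split; lra.
right; exists (a + b - t1); first by apply/andP; split; lra.
split => // t /andP[ta tb]; rewrite rhoE; apply: before; apply/andP; split; lra.
Qed.

End FirstExit.
(** * The distance dominates the coordinate distance *)

Section DistanceLowerBound.
Variables (R : realType) (n : nat) (M : topologicalType) (X : manifold R n M).
Variable g : riemannian_metric X.
Local Notation E := 'rV[R]_n.+1.
Implicit Types (y z : M) (gamma sigma : R -> M).

Section Ball.
Variables (x : M) (k r : R).
Let c := chart_at X x.
Let p0 := fwd c x.
Hypothesis k_ge0 : 0 <= k.
Hypothesis ball_cod : [set q | `|q - p0| <= r] `<=` chart_cod c.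
Hypothesis ball_metric : forall q, `|q - p0| <= r -> forall v,
  k * tnorm g x v <= bnorm (chart_inner g c q) v.

(** The alternative for a curve of length [l] from [z] to the point with
    coordinates [p]: up to the factor [k] it is at least as long as its own
    chord, or as a chord from the bounding sphere.  The end point is the one
    known to lie in the ball, since in the shadowing property the pseudo-orbit is the second
    argument of the distance. *)
Definition reaches (p : E) z (l : \bar R) :=
  (chart_ball c p0 r z /\ ((k * tnorm g x (fwd c z - p))%:E <= l)%E) \/
  (exists2 q, `|q - p0| = r & ((k * tnorm g x (q - p))%:E <= l)%E).

Lemma C1_curve_reaches sigma (a b : R) : C1_curve X sigma -> a < b ->
  chart_ball c p0 r (sigma b) ->
  reaches (fwd c (sigma b)) (sigma a)
    (\int[lebesgue_measure]_(t in `]a, b[) speed g sigma t)%E.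
Proof.
move=> sC1 ab sb.
have ac : atlas X c by exact: chart_at_atlas.
have flip p q : tnorm g x (p - q) = bnorm (inner g x) (q - p).
  by rewrite -opprB; exact: bnormN (inner_bilin g x) (q - p).
have [inside|[t1 /andP[at1 t1b] [cd t1r after]]] :=
  last_entry X sC1.1 (ltW ab) ball_cod sb.
- left; split; first by apply: inside; rewrite lexx ltW.
  rewrite flip.
  apply: (length_chart_ge (inner_bilin g x) (@inner_pos _ _ _ _ g x) k_ge0 sC1 ac ab).
    by move=> z /inside[].
  by move=> z /inside[_ zr] v; apply: ball_metric; exact: ltW.
- right; exists (fwd c (sigma t1)) => //; rewrite flip.
  apply: (@le_trans _ _ (\int[lebesgue_measure]_(t in `]t1, b[) speed g sigma t)%E).
    have upto (w : R) : t1 <= w <= b ->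
        chart_dom c (sigma w) /\ `|fwd c (sigma w) - p0| <= r.
      move=> /andP[t1w wb]; move: t1w; rewrite le_eqVlt => /predU1P[<-|t1w].
        by rewrite t1r.
      have [cwd cwr] : chart_ball c p0 r (sigma w) by apply: after; rewrite t1w.
      by split => //; exact: ltW.
    apply: (length_chart_ge (inner_bilin g x) (@inner_pos _ _ _ _ g x) k_ge0 sC1 ac t1b).
      by move=> z /upto[].
    by move=> z /upto[_ zr] v; exact: ball_metric.
  apply: integral_subset_le => [t _|]; first exact: speed_ge0.
  by move=> t /=; rewrite !in_itv/= => /andP[t1t ->]; rewrite (le_lt_trans at1).
Qed.

Lemma piecewise_C1_reaches gamma : piecewise_C1 X gamma ->
  chart_ball c p0 r (gamma 1) ->
  reaches (fwd c (gamma 1)) (gamma 0) (curve_length g gamma).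
Proof.
move=> [s [ps s1 pieces]] g1.
have t0 p : tnorm g x (p - p) = 0 by rewrite subrr; exact: bnorm0 (inner_bilin g x).
have triangle p q q' : tnorm g x (q' - p) <= tnorm g x (q - p) + tnorm g x (q' - q).
  have -> : q' - p = (q - p) + (q' - q) by rewrite [RHS]addrC addrA subrK.
  exact: (bnormD (inner_bilin g x) (@inner_pos _ _ _ _ g x)).
have last1 : nth 0 (0 :: s) (size s) = 1 by rewrite -s1 (last_nth 0).
(* backward induction on the break points, starting from the end of the curve *)
have steps i : (i <= size s)%N ->
    nth 0 (0 :: s) (size s - i) <= 1 /\
    reaches (fwd c (gamma 1)) (gamma (nth 0 (0 :: s) (size s - i)))
     (\int[lebesgue_measure]_(t in `](nth 0 (0 :: s) (size s - i)%N)%R, 1%R[)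
       speed g gamma t)%E.
  elim: i => [_|i IH si].
    rewrite subn0 last1; split => //; left; split => //=.
    by rewrite t0 mulr0; apply: integral_ge0 => t _; exact: speed_ge0.
  have [] := IH (ltnW si).
  have := subnSK si; set j := (size s - i.+1)%N => <-.
  have js : (j < size s)%N by rewrite /j -subn_gt0 subKn.
  rewrite -[nth 0 (0 :: s) j.+1]/(nth 0 s j).
  have ab := (pathP 0 ps) j js.
  have [sigma sC1 gs] := pieces j js.
  move: ab gs; set a := nth 0 (0 :: s) j; set b := nth 0 s j => ab gs b1 IHr.
  split; first by rewrite ltW// (lt_le_trans ab).
  have sub : `]b, 1%R[%classic `<=` `]a, 1%R[%classic.
    by move=> t /=; rewrite !in_itv/= => /andP[bt ->]; rewrite (lt_trans ab).
  have mono : (\int[lebesgue_measure]_(t in `]b, 1%R[) speed g gamma t <=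
               \int[lebesgue_measure]_(t in `]a, 1%R[) speed g gamma t)%E.
    by apply: integral_subset_le; [move=> t _; exact: speed_ge0|exact: sub].
  case: IHr => [[gb lb]|[q qr lq]]; last first.
    exact: or_intror (ex_intro2 _ _ q qr (le_trans lq mono)).
  have gsa : gamma a = sigma a by apply: gs; rewrite lexx ltW.
  have gsb : gamma b = sigma b by apply: gs; rewrite lexx ltW.
  have speedE : (\int[lebesgue_measure]_(t in `]a, b[) speed g sigma t =
      \int[lebesgue_measure]_(t in `]a, b[) speed g gamma t)%E.
    apply: eq_integral => t /set_mem /= tab.
    apply: speed_near_eq; rewrite in_itv/= in tab.
    have := @near_in_itvoo R a b t; rewrite in_itv/= => /(_ tab).
    apply: filterS => w; rewrite in_itv/= => /andP[aw wb].
    by rewrite gs// !ltW.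
  have := C1_curve_reaches sC1 ab; rewrite -gsb speedE => /(_ gb) piece.
  have add : (\int[lebesgue_measure]_(t in `]b, 1%R[) speed g gamma t +
      \int[lebesgue_measure]_(t in `]a, b[) speed g gamma t <=
      \int[lebesgue_measure]_(t in `]a, 1%R[) speed g gamma t)%E.
    apply: integral_setU_le; [by move=> t _; exact: speed_ge0| |exact: sub|].
      rewrite -subset0 => t [] /=; rewrite !in_itv/= => /andP[bt _] /andP[_ tb].
      by move: (lt_trans bt tb); rewrite ltxx.
    move=> t /=; rewrite !in_itv/= => /andP[-> tb] /=.
    exact: lt_le_trans tb b1.
  have glue q : ((k * tnorm g x (q - fwd c (gamma b)))%:E <=
        \int[lebesgue_measure]_(t in `]a, b[) speed g gamma t)%E ->
      ((k * tnorm g x (q - fwd c (gamma 1)))%:E <=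
        \int[lebesgue_measure]_(t in `]a, 1%R[) speed g gamma t)%E.
    move=> la; apply: le_trans add; apply: le_trans (leeD lb la).
    by rewrite -EFinD lee_fin -mulrDr ler_wpM2l.
  rewrite -gsa in piece.
  case: piece => [[ga la]|[q qr lq]]; first exact: or_introl (conj ga (glue _ la)).
  exact: or_intror (ex_intro2 _ _ q qr (glue _ lq)).
have [_] := steps (size s) (leqnn _).
rewrite subnn /=.
have le01 : (\int[lebesgue_measure]_(t in `]0%R, 1%R[) speed g gamma t <=
    curve_length g gamma)%E.
  apply: integral_subset_le => [t _|]; first exact: speed_ge0.
  exact: subset_itv_oo_cc.
case=> [[g0 l0]|[q qr lq]]; first exact: or_introl (conj g0 (le_trans l0 le01)).
exact: or_intror (ex_intro2 _ _ q qr (le_trans lq le01)).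
Qed.

End Ball.

(** A curve crossing the sphere of radius [r] to end in the ball of radius
    [r / 2] has length at least [eta]; a shorter one stays in the ball, where
    the metric is almost constant. *)
Lemma rdist_lower_bound x (e : R) : 0 < e -> e < 1 ->
  exists r eta : R, [/\ 0 < r, 0 < eta & forall y z (D : R),
    chart_ball (chart_at X x) (fwd (chart_at X x) x) r y ->
    D < eta -> (rdist g z y <= D%:E)%E ->
    chart_dom (chart_at X x) z /\
    (1 - e) * tnorm g x (fwd (chart_at X x) z - fwd (chart_at X x) y) <= D].
Proof.
move=> e0 e1; set c := chart_at X x; set p0 := fwd c x.
have [r r0 rP] : exists2 r : R, 0 < r & forall q, `|q - p0| <= r ->
    chart_cod c q /\ forall v, (1 - e) * tnorm g x v <= bnorm (chart_inner g c q) v.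
  have := metric_near g x e0 e1; rewrite -/c -/p0 => /nbhs_ballP[r /= r0 rP].
  exists (r / 2); first by rewrite divr_gt0.
  move=> q qr; have qb : ball (fwd c x) r q.
    rewrite -ball_normE /= distrC; apply: le_lt_trans qr _.
    by rewrite ltr_pdivrMr// ltr_pMr// ltr1n.
  have [qc qm] := rP q qb; split; first exact: qc.
  by move=> v; have /andP[] := qm v.
have k0 : 0 < 1 - e by rewrite subr_gt0.
have [m m0 mP] := bnorm_lower (inner_bilin g x) (@inner_pos _ _ _ _ g x).
(* [m] compares the norm of T_x M with the sup norm, in which the ball is round *)
pose eta := (1 - e) * (m * (r / 2)).
have eta0 : 0 < eta by rewrite !mulr_gt0.
exists (r / 2); exists eta; split; [by rewrite divr_gt0|exact: eta0|].
move=> y z D [yd yr] Deta rD.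
have yr' : `|fwd c y - p0| < r.
  by apply: (lt_le_trans yr); rewrite ler_pdivrMr// ler_pMr// ler1n.
have far q : `|q - p0| = r -> eta <= (1 - e) * tnorm g x (q - fwd c y).
  move=> qr; rewrite /eta ler_wpM2l ?(ltW k0)//; apply: le_trans (mP _).
  rewrite ler_wpM2l ?(ltW m0)//.
  have -> : q - fwd c y = (q - p0) - (fwd c y - p0) by rewrite opprB addrA subrK.
  apply: le_trans (lerB_dist _ _); rewrite qr lerBrDr.
  by rewrite [leRHS]splitr lerD2l ltW.
have curves gamma : piecewise_C1 X gamma -> gamma 0 = z -> gamma 1 = y ->
    (chart_dom c z /\ ((1 - e) * tnorm g x (fwd c z - fwd c y))%:E <= curve_length g gamma)%E
    \/ (eta%:E <= curve_length g gamma)%E.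
  move=> gC1 gz gy.
  have sub1 : [set q | `|q - p0| <= r] `<=` chart_cod c by move=> q /rP[].
  have sub2 q : `|q - p0| <= r -> forall v,
     (1 - e) * tnorm g x v <= bnorm (chart_inner g c q) v by move=> /rP[].
  have := @piecewise_C1_reaches x (1 - e) r (ltW k0) sub1 sub2 gamma gC1.
  rewrite gy gz => /(_ (conj yd yr'))[[[zd _] lz]|[q qr lq]]; first by left.
  by right; apply: le_trans lq; rewrite lee_fin; exact: far.
have zd : chart_dom c z.
  have [_ [gamma [gC1 gz gy] <-] lt] : exists2 l, [set curve_length g gamma | gamma in
      [set gamma | [/\ piecewise_C1 X gamma, gamma 0 = z & gamma 1 = y]]] l & (l < eta%:E)%E.
    apply: contrapT => nex.
    have : (eta%:E <= rdist g z y)%E.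
      apply: le_ereal_inf_tmp => l lP; rewrite leNgt; apply/negP => lt.
      by apply: nex; exists l.
    by move=> /le_trans/(_ rD); rewrite lee_fin leNgt Deta.
  case: (curves gamma gC1 gz gy) => [[]//|].
  by rewrite leNgt lt.
split => //; rewrite leNgt; apply/negP => Dlt.
pose mn := Num.min ((1 - e) * tnorm g x (fwd c z - fwd c y)) eta.
have : (mn%:E <= rdist g z y)%E.
  apply: le_ereal_inf_tmp => _ [gamma [gC1 gz gy] <-].
  case: (curves gamma gC1 gz gy) => [[_]|]; apply: le_trans.
    by rewrite lee_fin ge_min lexx.
  by rewrite lee_fin ge_min lexx orbT.
by move=> /le_trans/(_ rD); rewrite lee_fin leNgt lt_min Dlt Deta.
Qed.

End DistanceLowerBound.
(** * Short curves *)

Section UpperBound.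
Variables (R : realType) (n : nat) (M : topologicalType) (X : manifold R n M).
Variable g : riemannian_metric X.
Local Notation E := 'rV[R]_n.+1.
Implicit Types (x y : M).

Lemma C1_curve_piecewise (gamma : R -> M) : C1_curve X gamma -> piecewise_C1 X gamma.
Proof.
move=> gC1; exists [:: 1]; split; [by rewrite /= ltr01|by []|].
by case=> // _; exists gamma.
Qed.

Lemma C1_curve_cst y : C1_curve X (fun=> y).
Proof.
split; first by move=> t; exact: cvg_cst.
move=> c ac; split; first by move=> t _; exact: differentiable_cst.
move=> v t _ /=.
rewrite (_ : (fun s => _) = fun=> 0); first exact: cvg_cst.
apply/funext => s.
by have /(congr1 (fun f : R^o -> E => f v)) := @diff_cst R R^o E (fwd c y) s.
Qed.

Lemma rdist_refl y : (rdist g y y <= 0)%E.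
Proof.
apply: (@le_trans _ _ (curve_length g (fun=> y))).
  apply: ereal_inf_lbound; exists (fun=> y) => //; split => //.
  by apply: C1_curve_piecewise; exact: C1_curve_cst.
rewrite /curve_length integral0_eq// => t _.
rewrite /velocity (_ : _ \o _ = cst (fwd (chart_at X y) y))// derive1_cst.
by rewrite /tnorm (bilin0l (inner_bilin g y)) sqrtr0.
Qed.

(** A C^1 curve must be defined and stay in [M] for all times, so a segment is
    parametrized by a bounded function that increases from 0 to 1 on [0, 1]
    instead of by affine time. *)
Definition ramp (t : R) : R := sin (t * (pi / 2)).
Definition ramp' (t : R) : R := cos (t * (pi / 2)) * (pi / 2).

Lemma is_derive_ramp (t : R) : is_derive t (1 : R) ramp (ramp' t).
Proof.
rewrite /ramp /ramp'; apply: is_derive_eq.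
by rewrite scaler0 add0r; congr (_ * _); exact: mulr1.
Qed.

Lemma continuous_ramp' : continuous ramp'.
Proof.
move=> t; apply: cvgM; last exact: cvg_cst.
apply: continuous_comp; last exact: continuous_cos.
by apply: cvgM; [exact: cvg_id|exact: cvg_cst].
Qed.

Section Line.
Variables (p v : E).

Definition ramp_line (t : R^o) : E := p + ramp t *: v.

Lemma ramp_line_diff (t : R^o) : differentiable ramp_line t /\
  forall w : R^o, 'd ramp_line t w = (w * ramp' t) *: v.
Proof.
have dr : differentiable (ramp : R^o -> R^o) t.
  by apply/derivable1_diffP; exact: (@ex_derive _ _ _ _ _ _ _ (is_derive_ramp t)).
have drE (w : R^o) : 'd (ramp : R^o -> R^o) t w = w * ramp' t.
  rewrite (diff1E dr) derive1E.
  by rewrite (@derive_val _ _ _ _ _ _ _ (is_derive_ramp t)).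
have dz : differentiable (fun z : R^o => ramp z *: v) t by exact: differentiableZl.
have dc : differentiable (cst p : R^o -> E) t by exact: differentiable_cst.
have dD := differentiableD dc dz.
split; first exact: dD.
move=> w; have := congr1 (fun f : R^o -> E => f w) (diffD dc dz).
have dcE : 'd (cst p : R^o -> E) t w = 0.
  by have /(congr1 (fun f : R^o -> E => f w)) := @diff_cst R R^o E p t.
have dzE : 'd (fun z : R^o => ramp z *: v) t w = (w * ramp' t) *: v.
  by have := congr1 (fun f : R^o -> E => f w) (diffZl v dr); rewrite drE.
move=> H; apply: (etrans H).
by apply: (etrans (congr2 +%R dcE dzE)); rewrite add0r.
Qed.

End Line.

Lemma ramp_line_C1_curve p v c : atlas X c ->
  (forall t, chart_cod c (ramp_line p v t)) ->
  C1_curve X (bwd c \o ramp_line p v).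
Proof.
move=> ac lc.
have cl : continuous (ramp_line p v).
  by move=> t; apply: differentiable_continuous; exact: (ramp_line_diff p v t).1.
have cg : continuous (bwd c \o ramp_line p v : R^o -> M).
  move=> t; apply: continuous_comp; first exact: cl.
  exact: continuous_in_at (bwd_continuous (c:=c)) (lc t).
split; first exact: cg.
move=> c' ac'.
pose T := fwd c' \o bwd c.
have dT (t : R) : chart_dom c' (bwd c (ramp_line p v t)) ->
    differentiable T (ramp_line p v t) /\
    {for ramp_line p v t, continuous (fun q => 'd T q v)}.
  move=> ct; have [d1 d2] := transition_smooth ac ac' 1%N; split.
    by apply: d1; split; [exact: lc|exact: ct].
  by apply: (d2 v); rewrite inE; split; [exact: lc|exact: ct].
have dgE (t w : R^o) : chart_dom c' (bwd c (ramp_line p v t)) ->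
    'd (T \o ramp_line p v) t w = (w * ramp' t) *: 'd T (ramp_line p v t) v.
  move=> ct; rewrite (diff_comp (ramp_line_diff p v t).1 (dT t ct).1) /=.
  by rewrite (ramp_line_diff p v t).2 linearZ.
split.
  move=> t ct; exact: differentiable_comp (ramp_line_diff p v t).1 (dT t ct).1.
move=> w t /set_mem ct.
have near_eq : \forall s \near (t : R^o), (w * ramp' s) *: 'd T (ramp_line p v s) v =
    'd (T \o ramp_line p v) s w.
  have nb : nbhs (t : R^o) ((bwd c \o ramp_line p v) @^-1` chart_dom c').
    by apply: cg; exact: open_nbhs_of (chart_dom_open c') ct.
  by apply: filterS nb => s cs; rewrite dgE.
have lim : ((w * ramp' s) *: 'd T (ramp_line p v s) v) @[s --> (t : R^o)] -->
    (w * ramp' t) *: 'd T (ramp_line p v t) v.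
  apply: cvgZ.
    by apply: cvgM; [exact: cvg_cst|exact: continuous_ramp'].
  exact: (@continuous_comp R^o E E (ramp_line p v) (fun q => 'd T q v) t (cl t) (dT t ct).2).
rewrite -(dgE t w ct) in lim.
exact: cvg_trans (near_eq_cvg near_eq) lim.
Qed.

(** The slack in [tnorm g x v < 1] absorbs the variation of the metric along a
    short segment. *)
Lemma rdist_upper_bound x v : tnorm g x v < 1 ->
  exists2 d0 : R, 0 < d0 & forall d : R, 0 < d < d0 ->
    let c := chart_at X x in
    chart_cod c (fwd c x + d *: v) /\
    (rdist g x (bwd c (fwd c x + d *: v)) <= d%:E)%E.
Proof.
move=> v1; set c := chart_at X x; set a := tnorm g x v.
have a0 : 0 <= a by exact: sqrtr_ge0.
(* small enough for (1 + e) a <= 1 *)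
pose e := (1 - a) / 2.
have e0 : 0 < e by rewrite divr_gt0// subr_gt0.
have e1 : e < 1 by rewrite /e ltr_pdivrMr// mul1r; lra.
have ea : (1 + e) * a <= 1.
  rewrite -subr_ge0 (_ : 1 - _ = (1 - a) * (2 - a) / 2); last by rewrite /e; field.
  by rewrite divr_ge0// mulr_ge0 ?subr_ge0// ltW// (lt_trans v1)// ltr1n.
have := metric_near g x e0 e1; rewrite -/c => /nbhs_ballP[r /= r0 rP].
have v10 : 0 < `|v| + 1 by rewrite ltr_wpDl.
exists (r / (`|v| + 1)) => [|d /andP[d0 dr]]; first by rewrite divr_gt0.
have rampb t : `|ramp t| <= 1 by rewrite ler_norml sin_geN1 sin_le1.
have inball t : ball (fwd c x) r (ramp_line (fwd c x) (d *: v) t).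
  rewrite -ball_normE /= /ramp_line opprD addrA subrr sub0r normrN !normrZ.
  rewrite (gtr0_norm d0); apply: (@le_lt_trans _ _ (d * `|v|)).
    by rewrite ler_piMl// mulr_ge0// ltW.
  apply: (@le_lt_trans _ _ (d * (`|v| + 1))).
    by rewrite ler_wpM2l ?(ltW d0)// lerDl.
  by rewrite -ltr_pdivlMr.
have lc t : chart_cod c (ramp_line (fwd c x) (d *: v) t) by exact: (rP _ (inball t)).1.
have ramp1 : ramp 1 = 1 by rewrite /ramp mul1r sin_pihalf.
have ramp0 : ramp 0 = 0 by rewrite /ramp mul0r sin0.
have l1 : ramp_line (fwd c x) (d *: v) 1 = fwd c x + d *: v.
  by rewrite /ramp_line ramp1 scale1r.
have l0 : ramp_line (fwd c x) (d *: v) 0 = fwd c x.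
  by rewrite /ramp_line ramp0 scale0r addr0.
split; first by rewrite -l1.
have ac : atlas X c by exact: chart_at_atlas.
have gC1 := ramp_line_C1_curve ac lc.
pose gamma := bwd c \o ramp_line (fwd c x) (d *: v).
have fwdg : fwd c \o gamma = ramp_line (fwd c x) (d *: v).
  by apply/funext => t; rewrite /gamma /= bwdK.
apply: (@le_trans _ _ (curve_length g gamma)).
  apply: ereal_inf_lbound; exists gamma => //; split.
  - exact: C1_curve_piecewise.
  - by rewrite /gamma /= l0 fwdK//; exact: chart_at_dom.
  - by rewrite /gamma /= l1.
have speedE (t : R) : (speed g gamma t <= (`|ramp' t| * d)%:E)%E.
  have dg : differentiable (fwd c \o gamma : R^o -> E) t.
    by rewrite fwdg; exact: (ramp_line_diff _ _ t).1.
  have cgt : chart_dom c (gamma t) by apply: bwd_dom.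
  rewrite /speed lee_fin (tnorm_velocity g ac (gC1.1 t) cgt dg).
  rewrite fwdg (ramp_line_diff _ _ t).2 mul1r.
  rewrite (bnormZ (chart_inner_bilin g c _)) ler_wpM2l//.
  rewrite (bnormZ (chart_inner_bilin g c _)) (gtr0_norm d0).
  rewrite ler_piMr ?(ltW d0)//.
  have gt : fwd c (gamma t) = ramp_line (fwd c x) (d *: v) t by rewrite -fwdg.
  rewrite gt; apply: le_trans ea.
  by have /andP[] := (rP _ (inball t)).2 v.
have ramp'0 (t : R) : 0 <= t <= 1 -> 0 <= ramp' t.
  move=> /andP[t0 t1]; rewrite /ramp' mulr_ge0 ?divr_ge0 ?pi_ge0//.
  apply: cos_ge0_pihalf.
  rewrite ler_piMl ?divr_ge0 ?pi_ge0// andbT.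
  by apply: (@le_trans _ _ 0); rewrite ?oppr_le0 ?mulr_ge0 ?divr_ge0 ?pi_ge0.
have dF (t : R) : is_derive t (1 : R) (fun t => ramp t * d) (ramp' t * d).
  have h := is_derive_ramp t; apply: is_derive_eq.
  by rewrite scaler0 add0r; exact: mulrC.
have cF : continuous (fun t => ramp t * d).
  move=> t; apply: differentiable_continuous; apply/derivable1_diffP.
  exact: (@ex_derive _ _ _ _ _ _ _ (dF t)).
have FTC : (\int[lebesgue_measure]_(t in `[0%R, 1%R]) (ramp' t * d)%:E = d%:E)%E.
  rewrite (@continuous_FTC2 R (fun t => ramp' t * d) (fun t => ramp t * d) 0 1) ?ltr01//.
  - by rewrite ramp1 ramp0 mul1r mul0r sube0.
  - apply: continuous_subspaceT => t.
    by apply: cvgM; [exact: continuous_ramp'|exact: cvg_cst].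
  - split; first by move=> t _; exact: (@ex_derive _ _ _ _ _ _ _ (dF t)).
      by apply: cvg_at_right_filter; exact: cF.
    by apply: cvg_at_left_filter; exact: cF.
  - by move=> t _; rewrite derive1E (@derive_val _ _ _ _ _ _ _ (dF t)).
rewrite -FTC; apply: ge0_le_integral_lower => t /=; first by rewrite lee_fin sqrtr_ge0.
rewrite in_itv/= => t01; apply: le_trans (speedE t) _.
by rewrite lee_fin ger0_norm// ramp'0.
Qed.

End UpperBound.
(** * Linearization of the shadowing orbit *)

Section Linearization.
Variables (R : realType) (n : nat) (M : topologicalType) (X : manifold R n M).
Variable g : riemannian_metric X.
Local Notation E := 'rV[R]_n.+1.
Implicit Types (x y : M) (a b : R -> E).

Definition chart_point x (v : E) : M :=
  bwd (chart_at X x) (fwd (chart_at X x) x + v).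

Lemma near_scaled a (B : R) (P : set E) : nbhs (0 : E) P ->
  (\forall d \near 0^'+, `|a d| <= B) -> \forall d \near 0^'+, P (d *: a d).
Proof.
move=> /nbhs_ballP[r /= r0 rP] aB.
have K0 : 0 < `|B| + 1 by rewrite ltr_wpDl.
near=> d; apply: rP; rewrite -ball_normE /= sub0r normrN normrZ.
have d0 : 0 < d by near: d; exact: nbhs_right_gt.
have dr : d < r / (`|B| + 1).
  by near: d; apply: nbhs_right_lt; rewrite divr_gt0.
have ad : `|a d| <= B by near: d.
rewrite gtr0_norm//; apply: le_lt_trans (_ : d * (`|B| + 1) < r).
  rewrite ler_wpM2l ?(ltW d0)// (le_trans ad)// (le_trans (ler_norm B))//.
  by rewrite lerDl.
by rewrite -ltr_pdivlMr.
Unshelve. all: by end_near. Qed.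

(** Apply [h] to two points at displacements [d * a d] and [d * b d] from [x]:
    the images differ in coordinates by [d * Dh (b d - a d)] up to [o(d)],
    uniformly since [a] and [b] are bounded, and [rdist_lower_bound] bounds this
    difference by the distance of the images. *)
Lemma linearized_distance x (h : M -> M) a b (B L e e' : R) :
  smooth_at X h x -> 0 < B -> 0 < e -> e < 1 -> 0 < e' ->
  (\forall d \near 0^'+, `|a d| <= B) -> (\forall d \near 0^'+, `|b d| <= B) ->
  (\forall d \near 0^'+,
    (rdist g (h (chart_point x (d *: b d))) (h (chart_point x (d *: a d)))
      <= (L * d)%:E)%E) ->
  \forall d \near 0^'+,
    (1 - e) * tnorm g (h x) (tangent_map X h x (b d - a d)) <= L + e'.
Proof.
move=> [ch dh] B0 e0 e1 e'0 aB bB shadow.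
pose c := chart_at X x; pose c' := chart_at X (h x).
pose p0 := fwd c x.
have cx : chart_dom c x by exact: chart_at_dom.
have cx' : chart_dom c' (h x) by exact: chart_at_dom.
have dF : differentiable (local_map h c c') p0.
  by apply: dh => //; exact: chart_at_atlas.
have [r [eta [r0 eta0 lower]]] := rdist_lower_bound g (h x) e0 e1.
have [K K0 Kup] := bnorm_upper (inner_bilin g (h x)).
(* [tau] makes the two first-order errors together at most [e' * d] *)
pose tau := e' / (K * (2 * B)).
have tau0 : 0 < tau by rewrite divr_gt0// !mulr_gt0.
have estimate f : (\forall d \near 0^'+, `|f d| <= B) -> \forall d \near 0^'+,
    `|local_map h c c' (p0 + d *: f d) - local_map h c c' p0
      - d *: tangent_map X h x (f d)| <= tau * (d * B).
  move=> fB; have ns := near_scaled (differentiable_estimate dF tau0) fB.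
  apply: filterS3 fB (nbhs_right_gt 0) ns => d fd d0.
  rewrite linearZ [d *: f d + _]addrC => /le_trans; apply.
  by rewrite ler_wpM2l ?(ltW tau0)// normrZ gtr0_norm// ler_wpM2l ?(ltW d0).
have near_ball : \forall d \near 0^'+,
    chart_ball c' (fwd c' (h x)) r (h (chart_point x (d *: a d))).
  have bp0 : bwd c p0 = x by exact: fwdK.
  have nb : nbhs (bwd c p0) (h @^-1` chart_ball c' (fwd c' (h x)) r).
    rewrite bp0; apply: ch; apply: open_nbhs_of; first exact: chart_ball_open.
    by split => //; rewrite subrr normr0.
  have := bwd_near (fwd_cod cx) nb.
  rewrite (near_shift 0) => nb0.
  have := near_scaled nb0 aB; apply: filterS => d /=.
  by rewrite subr0 addrC => -[].
have nearL : \forall d \near 0^'+, L * d < eta.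
  have K1 : 0 < `|L| + 1 by rewrite ltr_wpDl.
  have dK : 0 < eta / (`|L| + 1) by rewrite divr_gt0.
  apply: filterS2 (nbhs_right_gt 0) (nbhs_right_lt dK) => d d0.
  rewrite ltr_pdivlMr// mulrC; apply: le_lt_trans.
  by rewrite ler_wpM2r ?(ltW d0)// (le_trans (ler_norm L))// lerDl.
apply: filterS (filterI (nbhs_right_gt 0) (filterI nearL (filterI near_ball
  (filterI shadow (filterI (estimate a aB) (estimate b bB)))))) =>
  d [d0 [Ld [yball [zy [ea eb]]]]].
have [_ main] := lower _ _ _ yball Ld zy.
move: main; rewrite -/c'.
set Fa := fwd c' (h (chart_point x (d *: a d))); set Fb := fwd c' (h (chart_point x (d *: b d))).
move=> main.
pose w := tangent_map X h x (b d - a d).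
have err : `|d *: w - (Fb - Fa)| <= tau * (d * B) *+ 2.
  rewrite mulr2n.
  have -> : d *: w - (Fb - Fa) =
     (Fa - local_map h c c' p0 - d *: tangent_map X h x (a d)) -
     (Fb - local_map h c c' p0 - d *: tangent_map X h x (b d)).
    rewrite /w linearB scalerBr; set A := d *: _; set A' := d *: _.
    set F0 := local_map _ _ _ _.
    by apply/rowP => i; rewrite !mxE; ring.
  apply: le_trans (ler_normB _ _) _.
  by apply: lerD.
have tri : d * tnorm g (h x) w <= tnorm g (h x) (Fb - Fa) + K * (tau * (d * B) *+ 2).
  have -> : d * tnorm g (h x) w = bnorm (inner g (h x)) (d *: w).
    by rewrite (bnormZ (inner_bilin g (h x))) gtr0_norm.
  rewrite -[d *: w](subrK (Fb - Fa)) addrC.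
  apply: le_trans (bnormD (inner_bilin g (h x)) (@inner_pos _ _ _ _ g (h x)) _ _) _.
  rewrite lerD2l; apply: le_trans (Kup _) _.
  by rewrite ler_wpM2l ?(ltW K0).
rewrite -(ler_pM2r d0) mulrAC -mulrA -/w.
have tauE : K * (tau * (d * B) *+ 2) = e' * d.
  by rewrite /tau -mulr_natr; field; rewrite !gt_eqF.
rewrite tauE in tri.
have k0 : 0 < 1 - e by rewrite subr_gt0.
apply: (@le_trans _ _ ((1 - e) * (tnorm g (h x) (Fb - Fa) + e' * d))).
  by rewrite ler_wpM2l// ltW.
rewrite mulrDr [leRHS]mulrDl; apply: lerD; first exact: main.
by rewrite ler_piMl ?mulr_ge0 ?(ltW d0) ?(ltW e'0)// gerBl ltW.
Qed.

End Linearization.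
Section ShadowTangent.
Variables (R : realType) (n : nat) (M : topologicalType) (X : manifold R n M).
Variable g : riemannian_metric X.
Local Notation E := 'rV[R]_n.+1.
Implicit Types (x y : M).

Lemma closed_of_cluster (T : topologicalType) (F : set_system T) (C : set T) w :
  closed C -> F C -> cluster F w -> C w.
Proof.
move=> /closure_id CE FC; rewrite clusterE => /(_ C FC).
by rewrite -CE.
Qed.

Lemma tangent_bound_closed x (h : M -> M) (k l : R) (v : E) : smooth_at X h x ->
  closed [set w : E | k * tnorm g (h x) (tangent_map X h x (w - v)) <= l].
Proof.
move=> [_ dh].
have dF : differentiable (local_map h (chart_at X x) (chart_at X (h x))) (fwd (chart_at X x) x).
  by apply: dh; [exact: chart_at_atlas|exact: chart_at_atlas|exact: chart_at_dom|exact: chart_at_dom].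
have cD : continuous (tangent_map X h x) by exact: diff_continuous dF.
have cN : continuous (tnorm g (h x)).
  exact: continuous_bnorm (inner_bilin g (h x)) (@inner_pos _ _ _ _ g (h x)).
apply: (@closed_comp _ _ (fun w : E => k * tnorm g (h x) (tangent_map X h x (w - v))) [set z | z <= l]); last exact: closed_le.
move=> w _.
have c1 : continuous_at w (fun w : E => w - v).
  exact: (cvgB (@cvg_id _ (nbhs w)) (cvg_cst v)).
have c2 := continuous_comp c1 (cD (w - v)).
have c3 := continuous_comp c2 (cN (tangent_map X h x (w - v))).
exact: (cvgM (cvg_cst k) c3).
Qed.

(** The pseudo-orbit is already at [z] at time 0, so that its only error is the
    jump from [f (finv y) = y] to [z]. *)
Definition jump_orbit (f finv : M -> M) (y z : M) (k : int) : M :=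
  match k with
  | Posz m => iter m f z
  | Negz m => iter m.+1 finv y
  end.

Lemma jump_pseudo_orbit (f finv : M -> M) y z (d : R) : cancel finv f ->
  0 <= d -> (rdist g y z <= d%:E)%E -> pseudo_orbit g f d (jump_orbit f finv y z).
Proof.
move=> fK d0 yz.
have rdd u : (rdist g u u <= d%:E)%E.
  by apply: le_trans (rdist_refl g u) _; rewrite lee_fin.
move=> [m|[|m]].
- have -> : (Posz m + 1 = Posz m.+1)%R by rewrite -PoszD addn1.
  exact: rdd.
- by rewrite /jump_orbit/= fK.
- have -> : (Negz m.+1 + 1 = Negz m)%R.
    by rewrite !NegzE -addn1 PoszD opprD subrK.
  by rewrite /jump_orbit/= fK; exact: rdd.
Qed.

(** The vector [w] is the first-order displacement of the orbits that shadow the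
    orbits jumping from [x] to [x + d v].  The bound at time 0 has to be sharp;
    at the other times any bound independent of [m] serves, and [2 L + 2] comes
    from spending a factor 2 on the comparison of distances. *)
Lemma shadow_tangent (f finv : M -> M) (L : R) x v : C1_diffeo X f finv ->
  1 <= L -> lipschitz_shadowing g f finv L -> tnorm g x v < 1 ->
  exists w, [/\ tnorm g x (w - v) <= L,
    forall m, tnorm g (iter m f x) (tangent_map X (iter m f) x (w - v)) <= 2 * L + 2 &
    forall m, tnorm g (iter m.+1 finv x) (tangent_map X (iter m.+1 finv) x w) <= 2 * L + 2].
Proof.
move=> [fK finvK f1 finv1] L1 [delta0 delta0_gt0 shadow] v1.
have L0 : 0 < L by exact: lt_le_trans L1.
have [d0 d0_gt0 upper] := rdist_upper_bound v1.
have half0 : (0 : R) < 2^-1 by rewrite invr_gt0.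
have half1 : (2^-1 : R) < 1 by rewrite invf_lt1// ltr1n.
have [r [eta [r0 eta0 lower]]] := rdist_lower_bound g x half0 half1.
have [m m0 mP] := bnorm_lower (inner_bilin g x) (@inner_pos _ _ _ _ g x).
pose c := chart_at X x; pose p0 := fwd c x.
have cx : chart_dom c x by exact: chart_at_dom.
have v10 : 0 < `|v| + 1 by rewrite ltr_wpDl.
pose d1 := Num.min (Num.min d0 delta0) (Num.min (eta / L) (r / (`|v| + 1))).
have d1_gt0 : 0 < d1 by rewrite !lt_min d0_gt0 delta0_gt0 !divr_gt0.
have : forall d, exists w : E, 0 < d < d1 ->
    (forall k, (rdist g (iterz f finv k (chart_point X x (d *: w)))
        (jump_orbit f finv x (chart_point X x (d *: v)) k) <= (L * d)%:E)%E) /\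
    tnorm g x (w - v) <= 2 * L.
  move=> d; have [/andP[dpos dd1]|nd] := boolP (0 < d < d1); last by exists 0.
  move: dd1; rewrite !lt_min => /andP[/andP[dd0 ddelta] /andP[deta dr]].
  have [|ucod xu] := upper d; first by rewrite dpos.
  have po := jump_pseudo_orbit finvK (ltW dpos) xu.
  have [|z zP] := shadow d _ _ po; first by rewrite dpos.
  pose u := chart_point X x (d *: v).
  have fu : fwd c u = p0 + d *: v by exact: bwdK.
  have ub : chart_ball c p0 r u.
    split; first exact: bwd_dom.
    rewrite fu addrC addKr normrZ gtr0_norm//.
    apply: (@le_lt_trans _ _ (d * (`|v| + 1))).
      by rewrite ler_wpM2l ?(ltW dpos)// lerDl.
    by rewrite -ltr_pdivlMr.
  have Ld : L * d < eta by rewrite mulrC -ltr_pdivlMr.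
  have [zd zl] := lower u z (L * d) ub Ld (zP 0).
  exists (d^-1 *: (fwd c z - p0)) => _.
  have zE : chart_point X x (d *: (d^-1 *: (fwd c z - p0))) = z.
    by rewrite scalerA divff ?gt_eqF// scale1r /chart_point addrC subrK fwdK.
  split; first by rewrite zE.
  have -> : d^-1 *: (fwd c z - p0) - v = d^-1 *: (fwd c z - fwd c u).
    rewrite fu opprD addrA [in RHS]scalerBr; congr (_ - _).
    by rewrite scalerA mulVf ?gt_eqF// scale1r.
  rewrite /tnorm -/(bnorm _ _) (bnormZ (inner_bilin g x)) gtr0_norm ?invr_gt0//.
  rewrite ler_pdivrMl//; move: zl; rewrite -/c /tnorm -/(bnorm _ _).
  by set t := bnorm _ _; lra.
move=> /choice[W WP].
pose B := `|v| + (2 * L) / m + 1.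
have B0 : 0 < B by rewrite ltr_wpDl// addr_ge0// divr_ge0// ?mulr_ge0// ltW.
have near01 : \forall d \near 0^'+, 0 < d < d1.
  apply: filterS2 (nbhs_right_gt 0) (nbhs_right_lt d1_gt0) => d ? ?.
  exact/andP.
have WB : \forall d \near 0^'+, `|W d| <= B.
  apply: filterS near01 => d /WP[_ Wl].
  rewrite -[W d](subrK v); apply: le_trans (ler_normD _ _) _.
  rewrite /B [`|v| + _]addrC -addrA lerD ?lerDl//.
  rewrite ler_pdivlMr// mulrC; apply: le_trans Wl; exact: mP.
have cK : compact [set w : E | `|w - 0| <= B] by exact: compact_norm_ball.
(* a cluster point avoids choosing subsequences: closed conditions that hold
   for all small [d] hold for [w] *)
have [|w [_ cw]] := cK (W @ 0^'+) _.
  by apply: filterS WB => d /=; rewrite subr0.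
have limit_bound h (a : E) (e e' : R) : smooth_at X h x -> 0 < e -> e < 1 -> 0 < e' ->
    (\forall d \near 0^'+,
      (rdist g (h (chart_point X x (d *: W d))) (h (chart_point X x (d *: a)))
      <= (L * d)%:E)%E) ->
    (1 - e) * tnorm g (h x) (tangent_map X h x (w - a)) <= L + e'.
  move=> sh e0 e1 e'0 sha.
  have BB : 0 < B + `|a| by rewrite ltr_pwDl.
  have near_bound := linearized_distance sh BB e0 e1 e'0 (a := fun=> a) (b := W) _ _ sha.
  have CC := @tangent_bound_closed x h (1 - e) (L + e') a sh.
  refine (closed_of_cluster CC _ cw).
  apply: near_bound.
    by apply: nearW => d; rewrite lerDr ltW.
  by apply: filterS WB => d /le_trans; apply; rewrite lerDl.
have fwd_bound k (e e' : R) : 0 < e -> e < 1 -> 0 < e' ->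
    (1 - e) * tnorm g (iter k f x) (tangent_map X (iter k f) x (w - v)) <= L + e'.
  move=> e0 e1 e'0; apply: limit_bound => //; first exact: smooth_at_iter.
  by apply: filterS near01 => d /WP[/(_ (Posz k))].
have bwd_bound k (e e' : R) : 0 < e -> e < 1 -> 0 < e' ->
    (1 - e) * tnorm g (iter k.+1 finv x) (tangent_map X (iter k.+1 finv) x w) <= L + e'.
  move=> e0 e1 e'0; rewrite -[w]subr0.
  apply: limit_bound => //; first exact: smooth_at_iter.
  apply: filterS near01 => d /WP[/(_ (Negz k)) sk _].
  by rewrite scaler0 /chart_point addr0 fwdK.
have coarse t : (1 - 2^-1) * t <= L + 1 -> t <= 2 * L + 2 by lra.
exists w; split.
- apply/ler_addgt0Pr => z z0.
  set t := tnorm g x (w - v).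
  have t0 : 0 <= t by exact: sqrtr_ge0.
  pose e := Num.min 2^-1 (z / (2 * (t + 1))).
  have tz : 0 < z / (2 * (t + 1)) by rewrite divr_gt0// mulr_gt0// ltr_wpDl.
  have e0 : 0 < e by rewrite lt_min half0.
  have e1 : e < 1 by rewrite gt_min half1.
  have z20 : 0 < z / 2 by rewrite divr_gt0.
  have := fwd_bound 0%N e (z / 2) e0 e1 z20.
  rewrite /= tangent_map_id -/t => b.
  have et : e * t <= z / 2.
    apply: (@le_trans _ _ (z / (2 * (t + 1)) * (t + 1))).
      by rewrite ler_pM ?(ltW e0)// ?ge_min ?lexx ?orbT// lerDl.
    by rewrite invfM mulrA divfK// gt_eqF// ltr_wpDl.
  by move: b; rewrite mulrBl mul1r; lra.
- by move=> k; apply: coarse; exact: fwd_bound.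
- by move=> k; apply: coarse; exact: bwd_bound.
Qed.

End ShadowTangent.
(** * Bounded tangent orbits and the splitting *)

Section Splitting.
Variables (R : realType) (n : nat) (M : topologicalType) (X : manifold R n M).
Variable g : riemannian_metric X.
Local Notation E := 'rV[R]_n.+1.
Implicit Types (x y : M) (U V : {vspace E}).

Lemma tnormZ x (a : R) (v : E) : tnorm g x (a *: v) = `|a| * tnorm g x v.
Proof. exact: bnormZ (inner_bilin g x) a v. Qed.

Lemma tnormD x (u v : E) : tnorm g x (u + v) <= tnorm g x u + tnorm g x v.
Proof. exact: bnormD (inner_bilin g x) (@inner_pos _ _ _ _ g x) u v. Qed.

Lemma tnormN x (v : E) : tnorm g x (- v) = tnorm g x v.
Proof. exact: bnormN (inner_bilin g x) v. Qed.

Lemma tnorm0 x : tnorm g x 0 = 0.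
Proof. exact: bnorm0 (inner_bilin g x). Qed.

Lemma tnorm_ge0 x (v : E) : 0 <= tnorm g x v.
Proof. exact: sqrtr_ge0. Qed.

Lemma tnorm_gt0 x (v : E) : v != 0 -> 0 < tnorm g x v.
Proof. exact: bnorm_gt0 (@inner_pos _ _ _ _ g x) v. Qed.

Lemma op_norm_bound x y U (A : {linear E -> E}) (l : R) :
  (op_norm g x y U A <= l%:E)%E ->
  forall u, u \in U -> tnorm g y (A u) <= l * tnorm g x u.
Proof.
move=> Al u uU; have [->|u0] := eqVneq u 0.
  by rewrite linear0 !tnorm0 mulr0.
have t0 := tnorm_gt0 x u0.
have : ((tnorm g y (A ((tnorm g x u)^-1 *: u)))%:E <= l%:E)%E.
  apply: le_trans Al; apply: ereal_sup_ubound.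
  exists ((tnorm g x u)^-1 *: u) => //; split; first exact: memvZ.
  by rewrite tnormZ gtr0_norm ?invr_gt0// mulVf ?gt_eqF.
by rewrite lee_fin linearZ/= tnormZ gtr0_norm ?invr_gt0// ler_pdivrMl// mulrC.
Qed.

Lemma op_norm_le x y U (A : E -> E) (l : R) : 0 <= l ->
  (forall u, tnorm g y (A u) <= l * tnorm g x u) ->
  (op_norm g x y U A <= l%:E)%E.
Proof.
move=> l0 Al; apply: ge_ereal_sup => _ [u [_ u1] <-].
by rewrite lee_fin (le_trans (Al u))// ler_piMr.
Qed.

Lemma geometric_bound_eq0 (t c l : R) : 0 <= t -> 0 < l < 1 ->
  (forall m, t <= c * l ^+ m.+1) -> t = 0.
Proof.
move=> t0 /andP[l0 l1] tm; apply/eqP; rewrite eq_le t0 andbT leNgt.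
apply/negP => tpos.
have c0 : 0 < c.
  by have := lt_le_trans tpos (tm 0%N); rewrite pmulr_lgt0// exprn_gt0.
have : `|l| < 1 by rewrite gtr0_norm.
move=> /cvg_expr/cvgrPdist_lt/(_ (t / c)) [|N _ /(_ N.+1 (leqnSn N))].
  by rewrite divr_gt0.
rewrite sub0r normrN gtr0_norm ?exprn_gt0// ltr_pdivlMr// mulrC.
by rewrite ltNge tm.
Qed.

Lemma iter_cancel (T : Type) (h k : T -> T) m : cancel k h ->
  cancel (iter m k) (iter m h).
Proof.
move=> kh; elim: m => [|m IH] z //.
by rewrite iterSr iterS kh IH.
Qed.

(** Vectors of [F] contract under [h], hence expand under [k].  If the [k]-orbit
    of [a + b] is bounded then so is that of [a], as [b] contracts; pulling it
    back by [h^m] shows that [|a|] is at most a constant times [l^m].  It is used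
    twice, with the roles of [f] and its inverse exchanged. *)
Lemma bounded_orbit_component_eq0 (h k : M -> M) (F G : M -> {vspace E})
    (C l B : R) x (a b : E) :
  C1_map X h -> C1_map X k -> cancel k h ->
  0 < C -> 0 < l < 1 ->
  (forall y u, u \in F y -> tangent_map X k y u \in F (k y)) ->
  (forall y m u, u \in F y ->
    tnorm g (iter m h y) (tangent_map X (iter m h) y u) <= C * l ^+ m * tnorm g y u) ->
  (forall y m u, u \in G y ->
    tnorm g (iter m k y) (tangent_map X (iter m k) y u) <= C * l ^+ m * tnorm g y u) ->
  a \in F x -> b \in G x ->
  (forall m, tnorm g (iter m.+1 k x) (tangent_map X (iter m.+1 k) x (a + b)) <= B) ->
  a = 0.
Proof.
move=> h1 k1 kh C0 l01 stab hF kG aF bG bounded.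
have [l0 l1] := andP l01.
have stabm m : tangent_map X (iter m k) x a \in F (iter m k x).
  elim: m => [|m IH]; first by rewrite tangent_map_id.
  by rewrite tangent_map_iterS//; exact: stab.
pose B2 := B + C * tnorm g x b.
have am m : tnorm g (iter m.+1 k x) (tangent_map X (iter m.+1 k) x a) <= B2.
  have -> : tangent_map X (iter m.+1 k) x a =
      tangent_map X (iter m.+1 k) x (a + b) + - tangent_map X (iter m.+1 k) x b.
    by rewrite linearD addrK.
  apply: le_trans (tnormD _ _ _) _; rewrite tnormN; apply: lerD; first exact: bounded.
  apply: le_trans (kG x m.+1 b bG) _; rewrite ler_wpM2r ?tnorm_ge0//.
  by rewrite ler_piMr ?(ltW C0)// exprn_ile1// ltW.
have B20 : 0 <= B2 by apply: le_trans (am 0%N); exact: tnorm_ge0.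
apply/eqP; apply: contraT => /(tnorm_gt0 x).
rewrite (@geometric_bound_eq0 (tnorm g x a) (C * B2) l) ?ltxx ?tnorm_ge0//.
move=> m; pose y := iter m.+1 k x.
have yx : iter m.+1 h y = x by exact: (iter_cancel _ kh).
have back : tangent_map X (iter m.+1 h) y (tangent_map X (iter m.+1 k) x a) = a.
  exact: tangent_map_cancel (iter_cancel m.+1 kh)
    (smooth_at_iter _ m.+1 k1) (smooth_at_iter _ m.+1 h1).
have : tnorm g x a <= C * l ^+ m.+1 * tnorm g y (tangent_map X (iter m.+1 k) x a).
  rewrite -[X in X <= _](congr2 (tnorm g) yx back).
  exact: hF (stabm m.+1).
move=> /le_trans; apply.
rewrite mulrAC ler_wpM2r ?exprn_ge0 ?(ltW l0)//.
by rewrite ler_wpM2l ?(ltW C0)// am.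
Qed.

Section Angle.
Variables (x : M) (U V : {vspace E}) (L : R).
Hypothesis sumUV : (U + V)%VS = fullv.
Hypothesis capUV : (U :&: V)%VS = 0%VS.
Hypothesis L_ge1 : 1 <= L.

Lemma capVU : (V :&: U)%VS = 0%VS. Proof. by rewrite capvC. Qed.

Lemma proj_sum v : daddv_pi U V v + daddv_pi V U v = v.
Proof. by rewrite daddv_pi_add// sumUV memvf. Qed.

Lemma proj_U u : u \in U -> daddv_pi U V u = u /\ daddv_pi V U u = 0.
Proof.
move=> uU; have e := daddv_pi_id capUV uU; split => //.
by have := proj_sum u; rewrite e => /eqP; rewrite addrC eq_sym -subr_eq subrr eq_sym => /eqP.
Qed.

Lemma proj_V u : u \in V -> daddv_pi V U u = u /\ daddv_pi U V u = 0.
Proof.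
move=> uV; have e := daddv_pi_id capVU uV; split => //.
by have := proj_sum u; rewrite e => /eqP; rewrite eq_sym -subr_eq subrr eq_sym => /eqP.
Qed.

Hypothesis projU_le : forall v, tnorm g x (daddv_pi U V v) <= L * tnorm g x v.

(** Write [v = s + u] and exchange the lengths of the two components without
    changing their directions: the new vector [v'] has the same norm as [v],
    because the cross term [<s, u>] is unchanged, and its first component has
    norm [|u|]. *)
Lemma complementary_proj_le v : tnorm g x (daddv_pi V U v) <= L * tnorm g x v.
Proof.
have L0 : 0 <= L by exact: le_trans L_ge1.
set s := daddv_pi U V v; set u := daddv_pi V U v.
have vE : v = s + u by rewrite proj_sum.
have sU : s \in U by exact: memv_pi.
have uV : u \in V by exact: memv_pi.
have [s0|s0] := eqVneq s 0.
  by rewrite vE s0 add0r ler_peMl ?tnorm_ge0.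
have [u0|u0] := eqVneq u 0.
  by rewrite u0 tnorm0 mulr_ge0 ?tnorm_ge0.
set p := tnorm g x s; set q := tnorm g x u.
have p0 : 0 < p by exact: tnorm_gt0.
have q0 : 0 < q by exact: tnorm_gt0.
pose v' := (q / p) *: s + (p / q) *: u.
have v'E : tnorm g x v' = tnorm g x v.
  rewrite /tnorm vE; congr Num.sqrt.
  have bs := inner_bilin g x; have bp := @inner_pos _ _ _ _ g x.
  rewrite !(bilin_sqrD bs) !(bilinZl bs) !(bilinZr bs).
  rewrite -!(bnorm_sqr bs bp) -[bnorm _ s]/p -[bnorm _ u]/q.
  by field; rewrite !gt_eqF.
have := projU_le v'; rewrite v'E linearD !linearZ/=.
rewrite (proj_U sU).1 (proj_V uV).2 scaler0 addr0 tnormZ.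
by rewrite gtr0_norm ?divr_gt0// -/p divfK ?gt_eqF.
Qed.

Lemma sin_angle_ge : 1 / L <= sin (angle g x U V) /\ asin (1 / L) <= angle g x U V.
Proof.
have L0 : 0 < L by exact: lt_le_trans L_ge1.
have iL1 : 1 / L <= 1 by rewrite ler_pdivrMr// mul1r.
have iL0 : 0 < 1 / L by rewrite divr_gt0.
have iLb : -1 <= 1 / L <= 1 by rewrite iL1 andbT (le_trans _ (ltW iL0)).
rewrite /angle; case: ifPn => [_|].
  by rewrite sin_pihalf; split => //; exact: asin_lepi2.
rewrite negb_or => /andP[_ V0].
set S := [set _ | _ in _].
have dist_ge v : v \in V -> tnorm g x v = 1 -> 1 / L <= dist_to g x v U.
  move=> vV v1; apply: lb_le_inf.
    by exists (tnorm g x (v - 0)); exists 0 => //=; exact: mem0v.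
  move=> _ [w wU <-]; rewrite ler_pdivrMr// mulrC -{1}v1.
  have := complementary_proj_le (v - w).
  by rewrite linearB/= (proj_V vV).1 (proj_U wU).2 subr0.
have dist_le v : tnorm g x v = 1 -> dist_to g x v U <= 1.
  move=> v1; apply: ge_inf.
    by exists 0 => _ [w _ <-]; exact: tnorm_ge0.
  by exists 0; rewrite ?subr0//=; exact: mem0v.
have [v vV v1] : exists2 v, v \in V & tnorm g x v = 1.
  have pV := memv_pick V; have p0 : vpick V != 0 by rewrite vpick0.
  have t0 := tnorm_gt0 x p0.
  exists ((tnorm g x (vpick V))^-1 *: vpick V); first exact: memvZ.
  by rewrite tnormZ gtr0_norm ?invr_gt0// mulVf ?gt_eqF.
have Sv : S (dist_to g x v U) by exists v.
have lbS : lbound S (1 / L) by move=> _ [u [uV u1] <-]; exact: dist_ge.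
have inf1 : 1 / L <= inf S by apply: lb_le_inf => //; exists (dist_to g x v U).
have inf2 : inf S <= 1.
  apply: le_trans (dist_le v v1); apply: ge_inf => //.
  by exists (1 / L).
have infb : -1 <= inf S <= 1.
  by rewrite inf2 andbT (le_trans _ inf1)//; case/andP: iLb.
have sE : sin (asin (inf S)) = inf S by rewrite asinK// in_itv.
rewrite sE; split => //; rewrite leNgt; apply/negP => lt.
have : sin (asin (inf S)) < sin (asin (1 / L)).
  by rewrite ltr_sin// in_itv/= asin_geNpi2// asin_lepi2.
by rewrite sE asinK ?in_itv// ltNge inf1.
Qed.

End Angle.

(** With [w] from [shadow_tangent], [w] is unstable and [w - u] is stable, so
    the stable component of [u] is [u - w]. *)
Lemma anosov_proj_stable_le (f finv : M -> M) (Es Eu : M -> {vspace E}) (L : R) x v :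
  C1_diffeo X f finv -> anosov_splitting g f finv Es Eu -> 1 <= L ->
  lipschitz_shadowing g f finv L ->
  tnorm g x (daddv_pi (Es x) (Eu x) v) <= L * tnorm g x v.
Proof.
move=> diffeo [split_ _ inv [C [l [C0 l01 contr]]]] L1 shadow.
have [fK finvK f1 finv1] := diffeo.
have L0 : 0 < L by exact: lt_le_trans L1.
have contrS y m u : u \in Es y ->
    tnorm g (iter m f y) (tangent_map X (iter m f) y u) <= C * l ^+ m * tnorm g y u.
  by apply: op_norm_bound; exact: (contr y m).1.
have contrU y m u : u \in Eu y ->
    tnorm g (iter m finv y) (tangent_map X (iter m finv) y u) <= C * l ^+ m * tnorm g y u.
  by apply: op_norm_bound; exact: (contr y m).2.
have stabU y u : u \in Eu y -> tangent_map X f y u \in Eu (f y).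
  move=> uE; rewrite -(inv y).2 -(lfunE (tangent_map X f y)).
  exact: memv_img.
have stabS y u : u \in Es y -> tangent_map X finv y u \in Es (finv y).
  rewrite -{1}(finvK y) -(inv (finv y)).1 => /memv_imgP[u0 u0E ->].
  rewrite lfunE; have := tangent_map_cancel u0 fK (C1_smooth_at (finv y) f1) (C1_smooth_at _ finv1).
  by rewrite finvK => ->.
have [sumE capE] := split_ x.
have small u : tnorm g x u < 1 -> tnorm g x (daddv_pi (Es x) (Eu x) u) <= L.
  move=> u1; have [w [wu wf wb]] := shadow_tangent diffeo L1 shadow u1.
  have wE := proj_sum sumE capE w.
  have w0 : daddv_pi (Es x) (Eu x) w = 0.
    apply: (@bounded_orbit_component_eq0 f finv Es Eu C l (2 * L + 2) x
      _ (daddv_pi (Eu x) (Es x) w)) => //; try exact: memv_pi.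
    by rewrite wE.
  have zE := proj_sum sumE capE (w - u).
  have z0 : daddv_pi (Eu x) (Es x) (w - u) = 0.
    apply: (@bounded_orbit_component_eq0 finv f Eu Es C l (2 * L + 2) x
      _ (daddv_pi (Es x) (Eu x) (w - u))) => //; try exact: memv_pi.
    by rewrite addrC zE => m; exact: wf.
  rewrite z0 addr0 in zE.
  have e : - daddv_pi (Es x) (Eu x) u = w - u.
    by rewrite -[RHS]zE linearB/= w0 sub0r.
  by rewrite -tnormN e.
(* [shadow_tangent] needs norm strictly less than 1: divide [v] by slightly more
   than its norm *)
apply/ler_addgt0Pr => e e0.
pose s := tnorm g x v + e / L.
have s0 : 0 < s by rewrite ltr_wpDl ?tnorm_ge0// divr_gt0.
have := small (s^-1 *: v); rewrite linearZ/= !tnormZ gtr0_norm ?invr_gt0//.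
rewrite ler_pdivrMl// => /(_ _) b.
have : tnorm g x (daddv_pi (Es x) (Eu x) v) <= s * L.
  by apply: b; rewrite ltr_pdivrMl// mulr1 /s ltrDl divr_gt0.
by rewrite /s mulrDl divfK ?gt_eqF// mulrC.
Qed.

End Splitting.

Theorem theorem3 (R : realType) (n : nat) (M : topologicalType)
    (X : manifold R n M) (g : riemannian_metric X)
    (M_connected : connected [set: M])
    (f finv : M -> M) (f_diffeo : C1_diffeo X f finv)
    (Es Eu : M -> {vspace 'rV[R]_n.+1})
    (f_anosov : anosov_splitting g f finv Es Eu)
    (L : R) (L_ge1 : 1 <= L) (f_shadow : lipschitz_shadowing g f finv L) :
  (forall x : M,
    [/\ (op_norm g x x fullv (daddv_pi (Es x) (Eu x)) <= L%:E)%E,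
        (op_norm g x x fullv (daddv_pi (Eu x) (Es x)) <= L%:E)%E &
        1 / L <= sin (angle g x (Es x) (Eu x))]) /\
  uniformly_transverse g Es Eu.
Proof.
have L_ge0 : 0 <= L by exact: le_trans L_ge1.
have [split_ _ _ _] := f_anosov.
have projs x v := anosov_proj_stable_le x v f_diffeo f_anosov L_ge1 f_shadow.
have angles x := sin_angle_ge (split_ x).1 (split_ x).2 L_ge1 (projs x).
split=> [x|].
  have projU := complementary_proj_le (split_ x).1 (split_ x).2 L_ge1 (projs x).
  split; [exact: op_norm_le (projs x)|exact: op_norm_le projU|].
  exact: (angles x).1.
exists (asin (1 / L)) => [|x]; last exact: (angles x).2.
have L_gt0 : 0 < L by exact: lt_le_trans L_ge1.
have iL0 : 0 < 1 / L by rewrite divr_gt0.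
have iL : -1 <= 1 / L <= 1.
  by rewrite (le_trans _ (ltW iL0))// ler_pdivrMr// mul1r.
have pi20 : 0 <= pi / 2 :> R by rewrite divr_ge0 ?pi_ge0.
rewrite -ltr_sin ?sin0 ?asinK ?in_itv//=; first by rewrite oppr_le0 pi20.
by rewrite asin_geNpi2 ?asin_lepi2.
Qed.
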